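(* Let $d\ge 2$, $q\ge 2$, and let $\mathbb{P}$ be a translation-invariant probability measure on $\Omega=\{0,1,\dots,q-1\}^{\mathbb{Z}^d}$. Suppose that $\mathbb{P}$ has the boundary-$1$ Markov property and the finite-energy property, and that the cluster-size distribution has a stretched exponential tail with exponent $\beta\in(0,1)$. Then, for every $\epsilon>0$, $$\left|\frac{\mathbb{P}(|C|=n+1)}{\mathbb{P}(|C|=n)}-1\right|\le\frac{\epsilon}{n^{(1-\beta)/2}}$$ for all sufficiently large $n$. Hence, for every $x>0$ and $0<\alpha\le(1-\beta)/2$, $$\lim_{n\to\infty}\frac{\mathbb{P}(|C|=n+\lfloor xn^\alpha\rfloor)}{\mathbb{P}(|C|=n)}=1.$$
   Context: Setting: $S=\{0,1,\dots,q-1\}$, $\Omega=S^{\mathbb{Z}^d}$; for $V\subset\mathbb{Z}^d$, $\omega_V$ is the restriction of $\omega\in\Omega$ to $V$. Finite-energy property: there exists $h\in(0,1)$ such that for all $s\in S$, $h\le\inf_{\sigma\in\Omega}\mathbb{P}(\omega(x)=s\mid\omega_{\mathbb{Z}^d\setminus\{x\}}=\sigma_{\mathbb{Z}^d\setminus\{x\}})\le\sup_{\sigma\in\Omega}\mathbb{P}(\omega(x)=s\mid\omega_{\mathbb{Z}^d\setminus\{x\}}=\sigma_{\mathbb{Z}^d\setminus\{x\}})\le 1-h$ (by translation invariance the site $x$ is irrelevant). Boundary-$s$ Markov property ($s\in S$): for finite $V\subset\mathbb{Z}^d$ let $N_V=\bigcup_{x\in V}(N_x\setminus V)$, where $N_x=\{y\in\mathbb{Z}^d:|y-x|=1\}$.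 $\mathbb{P}$ has the boundary-$s$ Markov property if for every finite $V\subset\mathbb{Z}^d$, given that all sites of $N_V$ are in the state $s$, the configuration on $V$ is conditionally independent of the configuration on $\mathbb{Z}^d\setminus(V\cup N_V)$. Clusters: a site $x$ is occupied if $\omega(x)=1$. $C(x)$ is the set of occupied sites that can be connected to $x$ by a nearest-neighbour path in $\mathbb{Z}^d$ passing only through occupied sites; $C(x)=\varnothing$ if $\omega(x)\ne 1$. $C=C(0)$, and $|X|$ is the number of sites of $X$. Stretched exponential tail with exponent $\beta\in(0,1)$: the limit $\nu=\lim_{n\to\infty}[\mathbb{P}(|C|=n)]^{1/n^\beta}=\lim_{n\to\infty}[\mathbb{P}(n\le|C|<\infty)]^{1/n^\beta}$ exists for some $0<\nu<1$ (both limits exist and are equal). *)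

(* Defs.v *)
From HB Require Import structures.
From mathcomp Require Import all_boot all_order all_algebra.
From mathcomp Require Import all_classical all_reals all_analysis.

Set Implicit Arguments.
Unset Strict Implicit.
Unset Printing Implicit Defensive.

Import Order.TTheory GRing.Theory Num.Theory.
Import numFieldTopology.Exports numFieldNormedType.Exports.

Local Open Scope classical_set_scope.
Local Open Scope ring_scope.

Definition site (d : nat) := 'rV[int]_d.

(* For integer vectors, unit Euclidean distance and unit l^1 distance are the
   same condition; the sup norm carried by matrices would be a different one. *)
Definition adj (d : nat) : rel (site d) :=
  fun x y => \sum_(i < d) `|y 0 i - x 0 i| == 1.

(* The state space is 'Z_q, whose elements are exactly 0, ..., q-1 when q >= 2;
   only the labels of the states matter, not the arithmetic modulo q. *)
Definition config (d q : nat) : Type := site d -> 'Z_q.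

HB.instance Definition _ (d q : nat) := Choice.copy (config d q) (site d -> 'Z_q).
HB.instance Definition _ (d q : nat) :=
  isPointed.Build (config d q) (fun=> 0).

Definition coord_events (d q : nat) (V : set (site d)) : set (set (config d q)) :=
  [set A | exists x s, V x /\ A = [set w | w x = s]].

Definition sigma_on (d q : nat) (V : set (site d)) : set (set (config d q)) :=
  <<s coord_events V >>.

(* Configurations with the product sigma-algebra. *)
Notation Omega d q :=
  (g_sigma_algebraType (@coord_events d q [set: site d])).

Section Measure.
Variables (R : realType) (d q : nat) (P : probability (Omega d q) R).

Definition translation_invariant : Prop :=
  forall (a : site d) (A : set (Omega d q)), measurable A ->
    P ((fun w : Omega d q => (fun x => w (x + a)) : Omega d q) @^-1` A) = P A.

(* p is a version of the conditional probability of A given the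
   sub-sigma-algebra generated by the coordinates in V. *)
Definition cond_prob_version (V : set (site d)) (A : set (Omega d q))
    (p : config d q -> R) : Prop :=
  [/\ measurable_fun [set: g_sigma_algebraType (@coord_events d q V)]
        (p : g_sigma_algebraType (@coord_events d q V) -> R),
      P.-integrable [set: Omega d q] (EFin \o p) &
      forall B, sigma_on V B -> (\int[P]_(w in B) (p w)%:E)%E = P (A `&` B)].

(* Conditional probabilities given the outside configuration are defined up to
   null sets: the bounds are required, over all configurations, of some
   version. *)
Definition finite_energy : Prop :=
  exists h : R, 0 < h < 1 /\
    forall (x : site d) (s : 'Z_q), exists p : config d q -> R,
      [/\ cond_prob_version (~` [set x]) [set w | w x = s] p,
          (h%:E <= ereal_inf (range (EFin \o p)))%E,
          (ereal_inf (range (EFin \o p)) <= ereal_sup (range (EFin \o p)))%E &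
          (ereal_sup (range (EFin \o p)) <= (1 - h)%:E)%E].

Definition condP (A E : set (Omega d q)) : R := fine (P (A `&` E)) / fine (P E).

Definition nbrs (x : site d) : set (site d) := [set y | adj x y].

Definition boundary (V : set (site d)) : set (site d) :=
  \bigcup_(x in V) (nbrs x `\` V).

Definition boundary_markov (s : 'Z_q) : Prop :=
  forall V : set (site d), finite_set V ->
  let E := [set w : Omega d q | forall y, boundary V y -> w y = s] in
  forall A B : set (Omega d q),
    sigma_on V A -> sigma_on (~` (V `|` boundary V)) B ->
    condP (A `&` B) E = condP A E * condP B E.

Definition occupied (w : config d q) : pred (site d) := fun x => w x == 1.

Definition occ_cluster (w : config d q) (x : site d) : set (site d) :=
  [set y | exists p : seq (site d),
     [/\ path (@adj d) x p, last x p = y & all (occupied w) (x :: p)]].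

(* Probabilities, as reals, that the cluster of the origin has exactly n sites,
   and that it is finite with at least n sites. *)
Definition prob_size (n : nat) : R :=
  fine (P [set w : Omega d q | (occ_cluster w 0 #= `I_n)%card]).

Definition prob_size_ge (n : nat) : R :=
  fine (P [set w : Omega d q | exists2 m, (n <= m)%N & (occ_cluster w 0 #= `I_m)%card]).

Definition stretched_exponential_tail (beta : R) : Prop :=
  exists nu : R, [/\ 0 < nu < 1,
    prob_size n `^ (n%:R `^ beta)^-1 @[n --> \oo] --> nu &
    prob_size_ge n `^ (n%:R `^ beta)^-1 @[n --> \oo] --> nu].

End Measure.

(* Main.v *)
Require Import Defs.
From mathcomp Require Import all_boot all_order all_algebra finmap.
From mathcomp Require Import all_classical all_reals all_analysis.
From mathcomp Require Import zify lra ring.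

Set Implicit Arguments.
Unset Strict Implicit.
Unset Printing Implicit Defensive.

Import Order.TTheory GRing.Theory Num.Theory.
Import numFieldTopology.Exports numFieldNormedType.Exports.

Local Open Scope classical_set_scope.
Local Open Scope ring_scope.

(** Write a(n) for P(|C| = n).  Tile the lattice by cubes of side three.  The
    centre z of a tile is a shell centre of the cluster if the other sites of
    the tile all belong to the cluster.  In dimension at least two the tile
    minus its centre is connected, so opening or closing z adds or removes the
    site z and does nothing else to the cluster; the origin, whose state
    decides whether there is a cluster at all, is never counted.  All
    neighbours of z are in state 1, hence the boundary-1 Markov property and
    translation invariance say that opening z multiplies the probability of
    the cluster by a constant lambda (weight_toggle), and finite energy gives
    0 < lambda < +oo.

    Let j and e be the numbers of open and closed shell centres.  Counting the
    pairs (cluster, shell centre) in two ways gives the exact identity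
      E[j phi(j, e); |C| = n+1] = lambda E[e phi(j+1, e-1); |C| = n]
    for every function phi (detailed_balance).  With phi = 1/j it bounds
    a(n+1) below by the mean of lambda e / (j+1) over clusters of size n, so
    a(n+1) >= (1 - delta) a(n) up to the contribution of the clusters with
    lambda e < (1 - delta)(j+1).  With the roles of j and e exchanged, the same
    identity bounds a(n) below by a(n+1).

    Two kinds of clusters have to be discarded.  Clusters with fewer than a
    small multiple of n shell centres are exponentially rare (few_shells):
    filling one tile that meets the cluster costs a constant factor by finite
    energy, there are about n ways to do it, and the result arises in few ways
    as long as it has few shell centres.  Clusters with many shell centres
    and lambda e < (1 - delta)(j+1) remain unbalanced, with delta/2 in place
    of delta, while t centres are closed one by one, for t of order delta n;
    each closure gains a factor 1 - delta/2 in the identity, so that these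
    clusters contribute at most (1 - delta/2)^t a(n-t) (unbalanced_small).

    Take delta = eps / n^((1-beta)/2).  Then delta t is of order
    delta^2 n = eps^2 n^beta, so the factor (1 - delta/2)^t is
    exp(-const n^beta).  Since t = o(n), the stretched exponential tail gives
    a(n-t) <= a(n) exp(o(n^beta)), and the discarded clusters are negligible
    with respect to delta a(n) (error_small).  This is the place where the
    exponent (1-beta)/2 is decided.  The limit along n + floor(x n^alpha)
    follows by multiplying at most x n^((1-beta)/2) ratios, each within
    eps / n^((1-beta)/2) of 1 in both directions. *)

(** * Finite connected sets of sites *)

Section Lattice.
Local Open Scope fset_scope.
Local Open Scope ring_scope.
Variable d : nat.
Implicit Types (x y z u v : site d) (A B : {fset site d}) (S T : pred (site d)).

Definition unit_step (p : 'I_d * bool) : site d :=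
  (if p.2 then - delta_mx 0 p.1 else delta_mx 0 p.1).

Lemma unit_stepE p i :
  unit_step p 0 i = if i == p.1 then (if p.2 then -1 else 1) else 0.
Proof.
by rewrite /unit_step; case: p.2; rewrite !mxE eqxx /=; case: eqP; rewrite ?oppr0.
Qed.

Lemma norm_unit_step p : \sum_(i < d) `|unit_step p 0 i| = 1.
Proof.
rewrite (bigD1 p.1) //= big1 ?addr0 => [|i ip]; rewrite /unit_step.
  by case: p.2; rewrite !mxE !eqxx.
by case: p.2; rewrite !mxE (negbTE ip) ?andbF ?oppr0 normr0.
Qed.

Lemma adjP x y : reflect (exists p, y = x + unit_step p) (adj x y).
Proof.
apply: (iffP eqP) => [H|[p ->]]; last first.
  by rewrite -(norm_unit_step p); apply: eq_bigr => i _; rewrite !mxE addrAC subrr add0r.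
have [i Hi] : exists i, y 0 i - x 0 i != 0.
  apply/existsP; apply: contra_eqT H => /existsPn H0.
  by rewrite big1 // => i _; move: (H0 i); rewrite negbK => /eqP ->; rewrite normr0.
move: H; rewrite (bigD1 i) //= => H.
have H1 : \sum_(j < d | j != i) `|y 0 j - x 0 j| = 0.
  have : 0 <= \sum_(j < d | j != i) `|y 0 j - x 0 j| by apply: sumr_ge0.
  move: H (Hi); set s := \sum_(j < d | _) _; move: (y 0 i) (x 0 i) => a b; lia.
have H2 j : j != i -> y 0 j = x 0 j.
  move=> ji; move/eqP: H1; rewrite psumr_eq0 // => /allP /(_ j).
  by rewrite mem_index_enum ji => /(_ isT) /=; rewrite normr_eq0 subr_eq0 => /eqP.
exists (i, y 0 i - x 0 i == -1); apply/rowP => j; rewrite /unit_step /=.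
case: (eqVneq j i) => [->|ji].
  move: H; rewrite H1 addr0.
  case: eqP => E H; rewrite !mxE !eqxx ?mulr1n; move: (y 0 i) (x 0 i) H E => a b; lia.
by case: ifP => _; rewrite !mxE (negbTE ji) andbF ?oppr0 addr0 H2.
Qed.

Lemma adj_sym x y : adj x y = adj y x.
Proof. by rewrite /adj; congr (_ == _); apply: eq_bigr => i _; rewrite distrC. Qed.

Definition neighbours x : {fset site d} :=
  [fset x + unit_step p | p in enum {: 'I_d * bool}].

Lemma in_neighbours x y : (y \in neighbours x) = adj x y.
Proof.
apply/imfsetP/adjP => /= [[p _ ->]|[p ->]]; first by exists p.
by exists p => //=; rewrite mem_enum.
Qed.

Definition outer_boundary A : {fset site d} :=
  (\bigcup_(x <- A) neighbours x) `\` A.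

Lemma outer_boundaryP A y :
  reflect (y \notin A /\ exists2 x, x \in A & adj x y) (y \in outer_boundary A).
Proof.
rewrite in_fsetD; apply: (iffP andP) => -[yA].
  by case/bigfcupP => x /andP[xA _]; rewrite in_neighbours => xy; split => //; exists x.
by case=> x xA xy; split=> //; apply/bigfcupP; exists x; rewrite ?xA ?in_neighbours.
Qed.

(** Stated for an arbitrary set of sites, so that [reach (occupied w) 0] is
    the cluster of the origin and [reach (mem A) 0] is connectivity inside A. *)
Definition reach S x y := exists p : seq (site d),
  [/\ path (@adj d) x p, last x p = y & all S (x :: p)].

Lemma reach_refl S x : S x -> reach S x x.
Proof. by move=> Sx; exists [::] => /=; rewrite Sx. Qed.

Lemma reach_step S x y z : reach S x y -> adj y z -> S z -> reach S x z.
Proof.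
case=> p [px <- Sp] yz Sz; exists (rcons p z).
by rewrite rcons_path px yz last_rcons -rcons_cons all_rcons Sz Sp.
Qed.

(** Paths grow at their end here: the induction carries the reached site, which
    is what rerouting arguments need. *)
Lemma reach_ind S x (Q : site d -> Prop) :
  (S x -> Q x) -> (forall y z, reach S x y -> Q y -> adj y z -> S z -> Q z) ->
  forall y, reach S x y -> Q y.
Proof.
move=> Q0 QS y [p [+ <- +]] {y}; elim/last_ind: p => [|p z IHp].
  by move=> _ /= /andP[/Q0].
rewrite rcons_path last_rcons -rcons_cons all_rcons => /andP[xp pz] /andP[Sz Sp].
by apply: (QS (last x p)) => //; [exists p|exact: IHp].
Qed.

Lemma reach_memr S x y : reach S x y -> S y.
Proof. by elim/reach_ind. Qed.

Lemma reach_trans S x y z : reach S x y -> reach S y z -> reach S x z.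
Proof.
move=> xy; elim/reach_ind => // u v _ xu uv Sv; exact: reach_step uv Sv.
Qed.

Lemma reach_meml S x y : reach S x y -> S x.
Proof. by case=> p [_ _ /=/andP[]]. Qed.

Lemma reach_sym S x y : reach S x y -> reach S y x.
Proof.
move=> xy; move: (reach_meml xy) => Sx; move: xy.
elim/reach_ind => [|u v xu ux uv Sv]; first exact: reach_refl.
rewrite adj_sym in uv.
exact: reach_trans (reach_step (reach_refl Sv) uv (reach_memr xu)) ux.
Qed.

Lemma reach_sub S T x y : {subset S <= T} -> reach S x y -> reach T x y.
Proof.
move=> ST [p [px pl /allP Sp]]; exists p; split => //.
by apply/allP => u /Sp /ST.
Qed.

Definition animal A := 0 \in A /\ forall y, y \in A -> reach (mem A) 0 y.

(** A connected set whose outer boundary is closed is a full component: a path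
    leaving it would have to cross the boundary. *)
Lemma animal_component A S : animal A -> {subset A <= S} ->
  (forall y, y \in outer_boundary A -> ~~ S y) ->
  forall y, reach S 0 y <-> y \in A.
Proof.
move=> [A0 Ac] AS bS y; split; last by move=> /Ac; exact: reach_sub.
elim/reach_ind => // u v _ uA uv Sv; apply/negPn/negP => vA.
by move: (bS v); rewrite Sv => /(_ _)/negP; apply => //; apply/outer_boundaryP; split => //; exists u.
Qed.

Lemma component_animal A S : A != fset0 -> (forall y, reach S 0 y <-> y \in A) ->
  [/\ animal A, {subset A <= S} & forall y, y \in outer_boundary A -> ~~ S y].
Proof.
move=> /fset0Pn[y0 /[dup] y0A] + SA => /SA y0r.
have A0 : 0 \in A by apply/SA/reach_refl; exact: reach_meml y0r.
split.
- split => // y /SA; elim/reach_ind => [_|u v xu IH uv Sv]; first exact: reach_refl.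
  by apply: (reach_step IH uv); apply/SA; exact: reach_step xu uv Sv.
- by move=> y /SA/reach_memr.
- move=> y /outer_boundaryP[yA [x /SA xA xy]]; apply: contra yA => Sy.
  by apply/SA; exact: reach_step xA xy Sy.
Qed.

Fixpoint graph_ball (n : nat) : {fset site d} :=
  if n is m.+1 then graph_ball m `|` \bigcup_(x <- graph_ball m) neighbours x else [fset 0].

Lemma ball_path p : path (@adj d) 0 p -> last 0 p \in graph_ball (size p).
Proof.
elim/last_ind: p => [_|p z IHp]; first by rewrite inE.
rewrite rcons_path last_rcons size_rcons => /andP[/IHp pb pz] /=.
by apply/fsetUP; right; apply/bigfcupP; exists (last 0 p); rewrite ?pb ?in_neighbours.
Qed.

Lemma ball_mono m n : (m <= n)%N -> graph_ball m `<=` graph_ball n.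
Proof.
move=> /subnK <-; elim: (n - m)%N => [|k IHk]; first exact: fsubset_refl.
exact: fsubset_trans IHk (fsubsetUl _ _).
Qed.

(** A shortest path inside A visits each site once, so it has fewer than
    |A| steps.  This makes the animals of a given size a finite family. *)
Lemma animal_ball A n : animal A -> (#|` A| <= n)%N -> A `<=` graph_ball n.
Proof.
move=> [A0 Ac] An; apply/fsubsetP => y /Ac[p [pp <- +]].
case/shortenP: pp => p' pp' up' p'p /= /andP[_ /allP pA].
apply: (fsubsetP (ball_mono _)) (ball_path pp').
apply: leq_trans An; apply: ltnW; apply: (uniq_leq_size up') => u.
by rewrite inE => /orP[/eqP-> //|/p'p/pA].
Qed.

End Lattice.

(** * The tiling by cubes of side three *)

Section Tiles.
Local Open Scope fset_scope.
Local Open Scope ring_scope.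
Variable d : nat.
Implicit Types (x y z u v : site d) (A B : {fset site d}) (S T : pred (site d)).

Definition unit_cube : {fset site d} :=
  [fset (\row_i (((f : {ffun 'I_d -> 'I_3}) i : nat)%:Z - 1)) | f in enum {ffun 'I_d -> 'I_3}].

Definition tile z : {fset site d} := [fset z + u | u in unit_cube].

Lemma in_tile y z : (y \in tile z) = [forall i, `|y 0 i - z 0 i| <= 1].
Proof.
apply/imfsetP/forallP => /= [[u /imfsetP[f _ ->] ->] i|H].
  rewrite !mxE addrAC subrr add0r; case: (f i) => k /= ?; lia.
have Hlt i : (absz (y 0 i - z 0 i + 1)%R < 3)%N.
  by move: (H i); move: (y 0 i) (z 0 i) => a b; lia.
exists (\row_i ((([ffun i => Ordinal (Hlt i)] : {ffun 'I_d -> 'I_3}) i : nat)%:Z - 1)).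
  by apply/imfsetP; exists [ffun i => Ordinal (Hlt i)] => //=; rewrite mem_enum.
apply/rowP => i; rewrite !mxE ffunE /=.
by move: (H i); move: (y 0 i) (z 0 i) => a b; lia.
Qed.

Definition tile_size := #|` unit_cube|.

Lemma card_tile z : #|` tile z| = tile_size.
Proof. by rewrite card_imfset //; exact: addrI. Qed.

Lemma mem_tile z : z \in tile z.
Proof. by rewrite in_tile; apply/forallP => i; rewrite subrr normr0. Qed.

(** The centre of the tile that contains x: the tiles are the cubes of side
    three centred at the sites all of whose coordinates are multiples of 3. *)
Definition anchor x : site d := \row_i (3 * divz (x 0 i + 1) 3).

Lemma tile_of_anchor x : x \in tile (anchor x).
Proof. rewrite in_tile; apply/forallP => i; rewrite mxE; lia. Qed.

Lemma anchor_tile z y : anchor z = z -> (y \in tile z) = (anchor y == z).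
Proof.
move=> cz; rewrite in_tile; apply/forallP/eqP => [H|<- i]; last by rewrite mxE; lia.
apply/rowP => i; move/rowP: cz => /(_ i); move: (H i); rewrite !mxE.
by move: (y 0 i) (z 0 i) => a b; lia.
Qed.

Lemma anchor_id x : anchor (anchor x) = anchor x.
Proof. apply/rowP => i; rewrite !mxE; lia. Qed.

(** Move from y to the centre by correcting one coordinate after another; the
    site reached after k corrections is [w k]. *)
Lemma tile_connected z y S : {subset tile z <= S} -> y \in tile z -> reach S y z.
Proof.
move=> zS; rewrite in_tile => /forallP yz.
pose w k : site d := \row_i (if (i < k)%N then z 0 i else y 0 i).
have wS k : S (w k).
  apply: zS; rewrite in_tile; apply/forallP => i; rewrite mxE; case: ifP => _ //.
  by rewrite subrr normr0.
suff H k : (k <= d)%N -> reach S y (w k).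
  rewrite (_ : z = w d); first exact: H.
  by apply/rowP => i; rewrite mxE ltn_ord.
elim: k => [_|k IHk kd].
  rewrite (_ : w 0%N = y); last by apply/rowP => i; rewrite mxE.
  apply: reach_refl; apply: zS; rewrite in_tile; exact/forallP.
have [e|ne] := eqVneq (w k) (w k.+1); first by rewrite -e; apply/IHk/ltnW.
apply: (reach_step (IHk (ltnW kd)) _ (wS _)).
pose j := Ordinal kd.
have wj i : i != j -> w k.+1 0 i = w k 0 i.
  move=> ij; rewrite !mxE ltnS leq_eqVlt; case: eqP => //= e.
  by case/eqP: ij; apply: val_inj.
have nej : w k 0 j != w k.+1 0 j.
  apply: contra_neq ne => e; apply/rowP => i.
  by have [->|/wj] := eqVneq i j.
apply/adjP; exists (j, w k 0 j - w k.+1 0 j == 1); apply/rowP => i.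
have [->|ij] := eqVneq i j; last first.
  by rewrite wj // /unit_step; case: ifP => _; rewrite !mxE (negbTE ij) andbF ?oppr0 addr0.
have wkj : w k 0 j = y 0 j by rewrite mxE ltnn.
have wk1j : w k.+1 0 j = z 0 j by rewrite mxE ltnSn.
move: nej (yz j); rewrite [RHS]mxE wkj wk1j /unit_step.
case: ifP => /=; rewrite !mxE /= !eqxx ?mulr1n;
  move: (y 0 j) (z 0 j) => a b; lia.
Qed.

(** Two steps in different directions commute, so the path goes around the
    centre through the corner z + p + p'. *)
Lemma reach_shell_neq S z (p p' : 'I_d * bool) : p.1 != p'.1 ->
  {subset tile z `\ z <= S} -> reach S (z + unit_step p) (z + unit_step p').
Proof.
move=> pp' zS.
have m (q : 'I_d * bool) : S (z + unit_step q).
  apply: zS; rewrite in_fsetD1 in_tile; apply/andP; split.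
    apply/eqP => /rowP /(_ q.1); rewrite mxE unit_stepE eqxx; move: (z 0 q.1) => a; case: q.2; lia.
  apply/forallP => i; rewrite mxE unit_stepE; move: (z 0 i) => a; case: eqP; case: q.2; lia.
have m2 : S (z + unit_step p + unit_step p').
  apply: zS; rewrite in_fsetD1 in_tile; apply/andP; split.
    apply/eqP => /rowP /(_ p.1).
    rewrite mxE [(z + _) _ _]mxE !unit_stepE eqxx (negbTE pp'); move: (z 0 p.1) => a; case: p.2; lia.
  apply/forallP => i; rewrite mxE [(z + _) _ _]mxE !unit_stepE; move: (z 0 i) => a.
  have [->|ip] := eqVneq i p.1; first by rewrite (negbTE pp'); case: p.2; lia.
  by case: eqP; case: p'.2; lia.
have e1 : adj (z + unit_step p) (z + unit_step p + unit_step p').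
  by apply/adjP; exists p'.
have e2 : adj (z + unit_step p + unit_step p') (z + unit_step p').
  by rewrite adj_sym; apply/adjP; exists p; rewrite addrAC.
exact: reach_step (reach_step (reach_refl (m p)) e1 m2) e2 (m p').
Qed.

(** Opposite neighbours of the centre are joined through a neighbour in another
    direction, which exists only in dimension at least two. *)
Lemma reach_shell S z u v : (1 < d)%N -> {subset tile z `\ z <= S} ->
  adj z u -> adj z v -> reach S u v.
Proof.
move=> hd zS /adjP[p ->] /adjP[p' ->].
have [e|] := eqVneq p.1 p'.1; last by move=> ?; exact: reach_shell_neq.
have [k kp] : exists k : 'I_d, k != p.1.
  have [e0|e0] := eqVneq (val p.1) 0%N.
    by exists (Ordinal hd); apply/eqP => /(congr1 val); rewrite /= e0.
  by exists (Ordinal (ltnW hd)); apply/eqP => /(congr1 val) /= /esym/eqP; rewrite (negbTE e0).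
apply: (@reach_trans _ _ _ (z + unit_step (k, false))); apply: reach_shell_neq => //=.
  by rewrite eq_sym.
by rewrite -e.
Qed.

End Tiles.

(** * Shells around tile centres *)

Section Shells.
Local Open Scope fset_scope.
Local Open Scope ring_scope.
Variable d : nat.
Implicit Types (x y z u v : site d) (A B : {fset site d}) (S T : pred (site d)).

(** The origin is excluded because closing it would destroy the cluster. *)
Definition shell_centres A : {fset site d} :=
  [fset z in [fset anchor x | x in A] | (z != 0) && (tile z `\ z `<=` A)].

Lemma shell_centresP A z : reflect
  [/\ z \in [fset anchor x | x in A], z != 0 & tile z `\ z `<=` A] (z \in shell_centres A).
Proof. by rewrite !inE /=; apply: and3P. Qed.

Lemma anchors_anchor A z : z \in [fset anchor x | x in A] -> anchor z = z.
Proof. by case/imfsetP => x _ ->; exact: anchor_id. Qed.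

Lemma shells_anchor A z : z \in shell_centres A -> anchor z = z.
Proof. by case/shell_centresP => /anchors_anchor. Qed.

Lemma neighbour_shell z x : adj z x -> x \in tile z `\ z.
Proof.
move=> /adjP[p ->]; rewrite in_fsetD1 in_tile; apply/andP; split.
  apply/eqP => /rowP /(_ p.1); rewrite mxE unit_stepE eqxx.
  by move: (z 0 p.1) => a; case: p.2; lia.
by apply/forallP => i; rewrite mxE unit_stepE; move: (z 0 i) => a; case: eqP; case: p.2; lia.
Qed.

Hypothesis hd : (1 < d)%N.

(** A path through z can be rerouted through the rest of the tile.  The
    induction on paths of [z |` A] keeps, when the path stands at z, a
    neighbour of z that was reached without z. *)
Lemma animal_toggle A z : z \in shell_centres A -> z \notin A ->
  animal (z |` A) <-> animal A.
Proof.
move=> zA zNA; have [_ z0 sA] := shell_centresP _ _ zA.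
have nA u : adj z u -> u \in A by move=> /neighbour_shell; apply/fsubsetP.
split=> -[A0 Ac].
  have A0' : 0 \in A by move: A0; rewrite in_fset1U eq_sym (negbTE z0).
  split=> // y yA.
  have ry : reach (mem (z |` A)) 0 y by apply: Ac; rewrite in_fset1U yA orbT.
  suff [/(_ yA)] : (y \in A -> reach (mem A) 0 y) /\
     (y = z -> exists2 u, adj z u & reach (mem A) 0 u) by [].
  move: {yA} ry; elim/reach_ind => [_|u v ru [IH1 IH2] uv].
    by split=> [_|/eqP]; [exact: reach_refl | rewrite eq_sym (negbTE z0)].
  move: (reach_memr ru); rewrite !inE => uzA /orP[/eqP vz|vA].
    split=> [vA|_]; first by rewrite vz (negbTE zNA) in vA.
    case/orP: uzA => [/eqP/IH2 //|uA].
    by exists u; [rewrite adj_sym -vz | exact: IH1].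
  split=> [_|vz]; last by rewrite -vz vA in zNA.
  case/orP: uzA => [/eqP uz|uA]; last exact: reach_step (IH1 uA) uv vA.
  have [w zw rw] := IH2 uz.
  apply: reach_trans rw _; apply: (reach_shell hd _ zw); last by rewrite -uz.
  by apply/fsubsetP.
split=> [|y]; first by rewrite in_fset1U A0 orbT.
have AzA : {subset A <= z |` A} by move=> u uA; rewrite in_fset1U uA orbT.
rewrite in_fset1U => /orP[/eqP->|/Ac]; last by apply: reach_sub.
have p0 : 'I_d * bool by split; [exact: Ordinal hd | exact: true].
have zp : adj z (z + unit_step p0) by apply/adjP; exists p0.
have /Ac /(reach_sub AzA) r := nA _ zp.
by apply: reach_step r _ _; [rewrite adj_sym | exact: fset1U1].
Qed.

(** No tile minus its centre contains the centre of another tile, so the state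
    of z does not matter to any shell. *)
Lemma shells_toggle A z : z \in shell_centres A -> shell_centres (z |` A) = shell_centres A.
Proof.
move=> /[dup] zA /shell_centresP[zc z0 _]; have cz := shells_anchor zA.
have cE : [fset anchor x | x in z |` A] = [fset anchor x | x in A].
  apply/fsetP => u; apply/imfsetP/imfsetP => /= -[x + ->].
    rewrite in_fset1U => /orP[/eqP ->|]; last by exists x.
    by case/imfsetP: zc => x' /= x'A e; exists x' => //; rewrite cz.
  by move=> xA; exists x => //; rewrite in_fset1U xA orbT.
apply/fsetP => u; apply/shell_centresP/shell_centresP => -[uc u0 /fsubsetP su]; split=> //.
- by rewrite -cE.
- apply/fsubsetP => v /[dup] vu /su; rewrite in_fset1U => /orP[/eqP vz|//].
  move: vu; rewrite in_fsetD1 vz anchor_tile ?cz; last exact: anchors_anchor uc.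
  by rewrite andNb.
- by rewrite cE.
- by apply/fsubsetP => v /su vA; rewrite in_fset1U vA orbT.
Qed.

Lemma shells_toggleD A z : z \in shell_centres A -> shell_centres (A `\ z) = shell_centres A.
Proof.
move=> zA; have [zc z0 sA] := shell_centresP _ _ zA; have cz := shells_anchor zA.
have [zinA|zNA] := boolP (z \in A); last first.
  by congr shell_centres; apply/fsetP => u; rewrite in_fsetD1; case: eqP => // ->; rewrite (negbTE zNA).
rewrite -[in RHS](fsetD1K zinA) shells_toggle //.
apply/shell_centresP; split=> //; last first.
  by apply/fsubsetP => v /[dup] /(fsubsetP sA); rewrite !in_fsetD1 => -> /andP[->].
pose p0 : 'I_d * bool := (Ordinal hd, true).
have zp : adj z (z + unit_step p0) by apply/adjP; exists p0.
have zt := neighbour_shell zp.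
apply/imfsetP; exists (z + unit_step p0) => /=.
  by rewrite in_fsetD1 (fsubsetP sA _ zt) andbT; move: zt; rewrite in_fsetD1 => /andP[].
by move: zt; rewrite in_fsetD1 anchor_tile // => /andP[_ /eqP].
Qed.

Lemma animal_fill A z : animal A -> z \in [fset anchor x | x in A] ->
  animal (A `|` tile z).
Proof.
move=> [A0 Ac] /imfsetP[/= x xA zx].
have S1 : {subset A <= A `|` tile z} by move=> u uA; rewrite in_fsetU uA.
have S2 : {subset tile z <= A `|` tile z} by move=> u uA; rewrite in_fsetU uA orbT.
split=> [|y]; first exact: S1.
rewrite in_fsetU => /orP[/Ac|yz]; first exact: reach_sub.
have xz : reach (mem (A `|` tile z)) x z.
  by apply: (tile_connected S2); rewrite zx tile_of_anchor.
apply: reach_trans (reach_sub S1 (Ac _ xA)) _; apply: reach_trans xz _.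
by apply: reach_sym; apply: (tile_connected S2).
Qed.

(** The tiles are disjoint: filling one of them does not complete another one. *)
Lemma shells_fill A z : z \in [fset anchor x | x in A] -> z != 0 ->
  shell_centres (A `|` tile z) = z |` shell_centres A.
Proof.
move=> zc z0; have cz := anchors_anchor zc.
have cE : [fset anchor x | x in A `|` tile z] = [fset anchor x | x in A].
  apply/fsetP => u; apply/imfsetP/imfsetP => /= -[x + ->].
    rewrite in_fsetU => /orP[|]; first by exists x.
    by rewrite anchor_tile // => /eqP ->; case/imfsetP: zc => x' /=; exists x'.
  by move=> xA; exists x => //; rewrite in_fsetU xA.
apply/fsetP => u; rewrite in_fset1U; apply/shell_centresP/orP; rewrite cE.
  case=> uc u0 /fsubsetP su; have cu := anchors_anchor uc.
  have [->|uz] := eqVneq u z; [by left|right; apply/shell_centresP; split=> //].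
  apply/fsubsetP => v /[dup] vu /su; rewrite in_fsetU => /orP[//|].
  move: vu; rewrite in_fsetD1 !anchor_tile // => /andP[_ /eqP ->].
  by rewrite (negbTE uz).
case=> [/eqP ->|/shell_centresP[uc u0 /fsubsetP su]]; split=> //.
  by apply/fsubsetP => v /fsetD1P[_ vz]; rewrite in_fsetU vz orbT.
by apply/fsubsetP => v /su vA; rewrite in_fsetU vA.
Qed.

(** A set of n sites meets at least n / 3^d tiles. *)
Lemma card_anchors A : (#|` A| <= tile_size d * #|` [fset anchor x | x in A]|)%N.
Proof.
have AS : A `<=` \bigcup_(z <- [fset anchor x | x in A]) tile z.
  apply/fsubsetP => x xA; apply/bigfcupP; exists (anchor x); rewrite ?tile_of_anchor ?andbT //.
  by apply/imfsetP; exists x.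
apply: leq_trans (fsubset_leq_card AS) _.
have card_bigcup (r : seq (site d)) :
    (#|` \bigcup_(z <- r) tile z| <= tile_size d * size r)%N.
  elim: r => [|z r IHr]; first by rewrite big_nil cardfs0.
  rewrite big_cons mulnS; apply: leq_trans (leq_add (leqnn _) IHr).
  by rewrite cardfsU -(card_tile z) leq_subr.
exact: card_bigcup.
Qed.

End Shells.

(** * Cylinder events and finite energy *)

Section CylinderEvents.
Local Open Scope fset_scope.
Local Open Scope classical_set_scope.
Local Open Scope ring_scope.
Variables (R : realType) (d q : nat) (P : probability (Omega d q) R).
Implicit Types (x y z : site d) (A B : {fset site d}) (S : seq (site d))
  (D : site d -> pred 'Z_q).

Definition cylinder S (D : site d -> pred 'Z_q) : set (Omega d q) :=
  [set w | forall y, y \in S -> D y (w y)].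

Lemma sigma_on_cylinder (V : set (site d)) S D :
  (forall y, y \in S -> V y) -> sigma_on V (cylinder S D).
Proof.
move=> SV; pose T := g_sigma_algebraType (@coord_events d q V).
suff : measurable (cylinder S D : set T) by [].
rewrite (_ : cylinder S D =
  \bigcap_(y in [set` S]) \bigcup_(s in [set s | D y s]) [set w : T | w y = s]).
  apply: fin_bigcap_measurable => [|y /= yS]; first exact: finite_seq.
  apply: fin_bigcup_measurable => [|s _]; first exact: finite_finset.
  by apply: sub_sigma_algebra; exists y, s; split => //; exact: SV.
apply/seteqP; split=> w /= Hw y yS.
  by exists (w y) => //=; exact: Hw.
by have [s /= Ds ->] := Hw y yS.
Qed.

Lemma measurable_cylinder S D : measurable (cylinder S D : set (Omega d q)).
Proof. exact: sigma_on_cylinder. Qed.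

Definition prob (E : set (Omega d q)) : R := fine (P E).

Lemma probE E : measurable E -> P E = (prob E)%:E.
Proof. by move=> mE; rewrite fineK // fin_num_measure. Qed.

Lemma prob_ge0 E : 0 <= prob E.
Proof. by rewrite fine_ge0. Qed.

Lemma prob_le1 E : measurable E -> prob E <= 1.
Proof. by move=> mE; rewrite -lee_fin -probE // probability_le1. Qed.

Lemma prob_le E F : measurable E -> measurable F -> E `<=` F -> prob E <= prob F.
Proof. by move=> mE mF EF; rewrite -lee_fin -!probE // le_measure // inE. Qed.

Lemma probID E F : measurable E -> measurable F -> prob E = prob (E `&` F) + prob (E `\` F).
Proof.
move=> mE mF; apply: EFin_inj; rewrite EFinD -!probE //; last 2 first.
- exact: measurableD.
- exact: measurableI.
rewrite -measureU //; last 3 first.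
- exact: measurableI.
- exact: measurableD.
- by rewrite setDE setIACA setICr setI0.
by rewrite setUIDK.
Qed.

(** The event is measurable outside x, so the conditional probability may be
    integrated over it. *)
Lemma finite_energy_pos : finite_energy P ->
  exists h : R, [/\ 0 < h, h < 1 & forall S D x t, x \notin S -> D x t ->
    h * prob (cylinder S D) <= prob (cylinder S D `&` [set w | w x = t])].
Proof.
case=> h [/andP[h0 h1] H]; exists h; split=> // S D x t xS Dt.
have [p [[_ ip Hp] hp _ _]] := H x t.
have mB := measurable_cylinder S D.
have sB : sigma_on (~` [set x]) (cylinder S D).
  by apply: sigma_on_cylinder => y yS /= yx; rewrite -yx yS in xS.
have mx : measurable ([set w | w x = t] : set (Omega d q)).
  by apply: sub_sigma_algebra; exists x, t.
have hpw w : h <= p w.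
  rewrite -lee_fin; apply: le_trans hp _; apply: ereal_inf_lbound; by exists w.
rewrite -lee_fin EFinM -!probE //; last exact: measurableI.
rewrite setIC -Hp // -integral_cst //; apply: ge0_le_integral => //.
- by move=> w _; rewrite lee_fin ltW.
- by apply: (measurable_funS measurableT (@subsetT _ _)); exact: measurable_int ip.
- by move=> w _; rewrite lee_fin.
Qed.

(** A state allowed by D is imposed on the sites of r one at a time, at the
    cost of a factor h each; a site that is already constrained costs nothing. *)
Lemma finite_energy_cylinder : finite_energy P ->
  exists h : R, [/\ 0 < h, h < 1 & forall r S D (t : site d -> 'Z_q), (forall x, D x (t x)) ->
    h ^+ size r * prob (cylinder S D) <= prob (cylinder (r ++ S) D)].
Proof.
move=> /finite_energy_pos[h [h0 h1 H]]; exists h; split=> // r S D t Dt.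
elim: r => [|x r IHr] /=; first by rewrite expr0 mul1r.
rewrite exprS -mulrA; apply: le_trans (ler_wpM2l (ltW h0) IHr) _.
have [xr|xr] := boolP (x \in r ++ S); last first.
  apply: le_trans (H _ _ _ (t x) xr (Dt x)) _; apply: prob_le.
  - apply: measurableI; first exact: measurable_cylinder.
    by apply: sub_sigma_algebra; exists x, (t x).
  - exact: measurable_cylinder.
  - move=> w [/= Hw wx] y; rewrite inE => /orP[/eqP ->|/Hw //]; by rewrite wx.
rewrite (_ : cylinder (x :: r ++ S) D = cylinder (r ++ S) D).
  by rewrite ler_piMl ?prob_ge0 // ltW.
apply/seteqP; split=> w Hw y yS; apply: Hw; first by rewrite inE yS orbT.
by move: yS; rewrite inE => /orP[/eqP ->|].
Qed.

(** The cluster of the origin is the animal A exactly when A is open and its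
    outer boundary is closed. *)
Definition cluster_pattern A : site d -> pred 'Z_q :=
  fun y s => if y \in A then s == 1 else s != 1.

Definition cluster_event A : set (Omega d q) :=
  cylinder (A `|` outer_boundary A)%fset (cluster_pattern A).

Lemma cluster_eventP A w : cluster_event A w <->
  (forall y, y \in A -> w y = 1) /\ (forall y, y \in outer_boundary A -> w y <> 1).
Proof.
rewrite /cluster_event /cylinder /cluster_pattern /=; split=> [H|[H1 H2] y].
  split=> y yA.
    by have := H y; rewrite in_fsetU yA => /(_ isT)/eqP.
  have := H y; rewrite in_fsetU yA orbT => /(_ isT).
  by case/outer_boundaryP: yA => /negbTE -> _ /eqP.
by rewrite in_fsetU; case: ifP => [/H1 -> //|_ /= /H2/eqP].
Qed.

Definition weight A : R := prob (cluster_event A).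

Lemma weight_ge0 A : 0 <= weight A. Proof. exact: prob_ge0. Qed.

Lemma measurable_cluster_event A : measurable (cluster_event A).
Proof. exact: measurable_cylinder. Qed.

Lemma Zq_0neq1 : (0 : 'Z_q) != 1.
Proof. by rewrite eq_sym oner_eq0. Qed.

(** Imposing open sites on the tile and closed sites around it, except where A
    is already open, turns the cluster A into A together with the tile.  Only
    boundedly many sites are changed, whatever A and z are. *)
Lemma weight_fill : finite_energy P ->
  exists2 h : R, 0 < h & forall A z, h * weight A <= weight (A `|` tile z)%fset.
Proof.
move=> /finite_energy_cylinder[h [h0 h1 H]].
pose N := size (enum {: 'I_d * bool}).
have card_nb x : (#|` neighbours x| <= N)%N.
  by apply: leq_trans (leq_imfset_card _ _ _) _; rewrite /N /= undup_id ?enum_uniq.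
pose F z : {fset site d} := (tile z `|` \bigcup_(x <- tile z) neighbours x)%fset.
exists (h ^+ (tile_size d + tile_size d * N)); first exact: exprn_gt0.
move=> A z; set A' := (A `|` tile z)%fset.
have card_F : (size (F z) <= tile_size d + tile_size d * N)%N.
  rewrite cardfsU; apply: leq_trans (leq_subr _ _) _; rewrite card_tile leq_add2l.
  rewrite -(card_tile z); elim: (enum_fset (tile z)) => [|x r IHr].
    by rewrite big_nil cardfs0.
  rewrite big_cons mulSn; apply: leq_trans (leq_add (card_nb x) IHr).
  by rewrite cardfsU leq_subr.
pose S : seq (site d) := ((A `|` outer_boundary A) `\` F z)%fset.
have tF y : y \in tile z -> y \in F z by move=> yz; rewrite in_fsetU yz.
have Dt x : cluster_pattern A' x (if x \in A' then 1 else 0).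
  by rewrite /cluster_pattern; case: (x \in A') => /=; rewrite ?eqxx ?Zq_0neq1.
apply: le_trans (_ : h ^+ size (F z) * prob (cylinder S (cluster_pattern A')) <= _).
  apply: ler_pM; [exact: exprn_ge0 (ltW h0)|exact: prob_ge0| |].
    by exact: (ler_wiXn2l (ltW h0) (ltW h1) card_F).
  apply: prob_le; try exact: measurable_cylinder.
  move=> w Hw y; rewrite in_fsetD => /andP[yF yA].
  have := Hw y yA; rewrite /cluster_pattern in_fsetU.
  by rewrite (contraNF (tF y) yF) orbF.
apply: le_trans (H _ _ _ _ Dt) _; apply: prob_le; try exact: measurable_cylinder.
move=> w Hw y yA'; apply: Hw; rewrite mem_cat in_fsetD.
have [//|yF] := boolP (y \in F z); rewrite /= in_fsetU.
have yt := contraNN (tF y) yF.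
move: yA'; rewrite in_fsetU => /orP[|/outer_boundaryP[]].
  by rewrite in_fsetU (negbTE yt) orbF => ->.
rewrite in_fsetU negb_or => /andP[yA _] [x]; rewrite in_fsetU => /orP[xA|xt] xy.
  by apply/orP; right; apply/outer_boundaryP; split=> //; exists x.
case/negP: yF; rewrite in_fsetU; apply/orP; right; apply/bigfcupP; exists x.
  by rewrite xt.
by rewrite in_neighbours.
Qed.

End CylinderEvents.

(** * The Markov property at a shell centre *)

Section ShellMarkov.
Local Open Scope fset_scope.
Local Open Scope classical_set_scope.
Local Open Scope ring_scope.
Variables (R : realType) (d q : nat) (P : probability (Omega d q) R).
Hypothesis hd : (1 < d)%N.
Implicit Types (x y z : site d) (A B : {fset site d}) (S : seq (site d))
  (D : site d -> pred 'Z_q).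

Local Notation pr := (prob P).

Definition open_nbrs z : set (Omega d q) := cylinder (neighbours z) (fun _ s => s == 1).
Definition open_site z : set (Omega d q) := [set w | w z = 1].

Lemma measurable_open_site z : measurable (open_site z).
Proof. by apply: sub_sigma_algebra; exists z, 1. Qed.

Lemma measurable_open_nbrs z : measurable (open_nbrs z).
Proof. exact: measurable_cylinder. Qed.

Hint Resolve measurable_open_site measurable_open_nbrs : core.

Lemma adj_irr x : adj x x = false.
Proof. by rewrite /adj big1 // => i _; rewrite subrr normr0. Qed.

(** The Markov property for the one-site set {z}, with the conditioning event
    multiplied out so that no division occurs. *)
Lemma markov_site z S D : boundary_markov P 1 ->
  z \notin S -> (forall y, y \in S -> ~~ adj z y) ->
  pr (open_site z `&` cylinder S D `&` open_nbrs z) * pr (open_nbrs z)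
  = pr (open_site z `&` open_nbrs z) * pr (cylinder S D `&` open_nbrs z).
Proof.
move=> M zS nS.
have bE y : boundary [set z] y <-> adj z y.
  split=> [[x /= -> []] //|zy]; exists z => //; split=> //= yz.
  by rewrite yz adj_irr in zy.
have EE : [set w : Omega d q | forall y, boundary [set z] y -> w y = 1] = open_nbrs z.
  apply/seteqP; split=> w /= H y.
    by rewrite in_neighbours => /bE/H ->.
  by move=> /bE; rewrite -in_neighbours => /H/eqP.
have sA : sigma_on [set z] (open_site z) by apply: sub_sigma_algebra; exists z, 1.
have sB : sigma_on (~` ([set z] `|` boundary [set z])) (cylinder S D).
  apply: sigma_on_cylinder => y yS /= [yz|/bE zy].
    by rewrite yz (negbTE zS) in yS.
  by move: (nS _ yS); rewrite zy.
have := M [set z] (finite_set1 z); rewrite /= EE => /(_ _ _ sA sB).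
rewrite /condP -/(pr _) -/(pr _) -/(pr _) -/(pr _).
have [E0 _|E0] := eqVneq (pr (open_nbrs z)) 0.
  have EZ F : measurable F -> pr (F `&` open_nbrs z) = 0.
    move=> mF; apply/eqP; rewrite eq_le prob_ge0 andbT -E0.
    by apply: prob_le => //; exact: measurableI.
  by rewrite E0 mulr0 EZ // mul0r.
by rewrite mulrACA -invfM => /(congr1 (fun u => u * (pr (open_nbrs z) * pr (open_nbrs z))));
  rewrite mulfVK ?mulf_neq0 // mulrA mulfVK.
Qed.

Lemma shift_open_nbrs z : translation_invariant P ->
  pr (open_nbrs z) = pr (open_nbrs 0) /\
  pr (open_site z `&` open_nbrs z) = pr (open_site 0 `&` open_nbrs 0).
Proof.
move=> T.
have nbr0 y : (y + z \in neighbours z) = (y \in neighbours 0).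
  by rewrite !in_neighbours /adj; congr (_ == _); apply: eq_bigr => i _; rewrite !mxE addrK subr0.
pose sh (w : Omega d q) : Omega d q := fun x => w (x + z).
have e1 : sh @^-1` (open_nbrs 0) = open_nbrs z.
  apply/seteqP; split=> w H y yN.
    by have := H (y - z); rewrite /sh subrK; apply; rewrite -nbr0 subrK.
  by apply: H; rewrite nbr0.
have e2 : sh @^-1` (open_site 0) = open_site z.
  by apply/seteqP; split=> w; rewrite /open_site /sh /= add0r.
split; first by rewrite -e1 /pr /prob T.
by rewrite -e1 -e2 -preimage_setI /pr /prob T //; exact: measurableI.
Qed.

(** Write the cluster events of [z |` A] and of A as the intersections of a
    cylinder event B away from z and its neighbours, the event that the
    neighbours of z are open, and the event that z is open, respectively
    closed.  The Markov property factors the state of z out, and translation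
    invariance makes the resulting ratio independent of z. *)
Lemma weight_toggle : boundary_markov P 1 -> translation_invariant P -> finite_energy P ->
  exists2 lam : R, 0 < lam & forall A z, z \in shell_centres A -> z \notin A ->
    weight P (z |` A)%fset = lam * weight P A.
Proof.
move=> M T FE.
have E0 : 0 < pr (open_nbrs 0).
  have [h [h0 h1 H]] := finite_energy_cylinder FE.
  have := H (neighbours 0) [::] (fun _ s => s == 1) (fun=> 1) (fun=> eqxx _).
  rewrite cats0; apply: lt_le_trans; rewrite pmulr_rgt0 ?exprn_gt0 //.
  rewrite (_ : cylinder _ _ = setT); first by rewrite /prob probability_setT.
  by apply/seteqP; split=> // w _ y.
have n0 : 0 \notin (neighbours 0 : {fset site d}) by rewrite in_neighbours adj_irr.
have A1 : 0 < pr (open_site 0 `&` open_nbrs 0).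
  have [h [h0 h1 H]] := finite_energy_pos FE.
  have := H (neighbours 0) (fun _ s => s == 1) 0 1 n0 (eqxx _).
  by rewrite setIC; apply: lt_le_trans; rewrite mulr_gt0.
have A0 : 0 < pr (open_nbrs 0 `\` open_site 0).
  have [h [h0 h1 H]] := finite_energy_pos FE.
  have m0 : measurable ([set w | w 0 = 0] : set (Omega d q)).
    by apply: sub_sigma_algebra; exists 0, 0.
  (* Finite energy is used for the state 0 at the origin, so D must accept it there. *)
  pose D y : pred 'Z_q := fun s => (y == 0) || (s == 1).
  have cD : cylinder (neighbours 0) D = open_nbrs 0.
    apply/seteqP; split=> w Hw y /[dup] yN /Hw; rewrite /D.
      by case: eqP yN n0 => [-> ->|].
    by move=> ->; rewrite orbT.
  have := H (neighbours 0) D 0 0 n0; rewrite cD /D eqxx => /(_ isT) H0.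
  apply: lt_le_trans (le_trans H0 (prob_le _ _ _ _)); first by rewrite mulr_gt0.
  - exact: measurableI.
  - exact: measurableD.
  - by move=> w [Ew /= w0]; split=> //=; rewrite /open_site /= w0 => /eqP; rewrite (negbTE (Zq_0neq1 q)).
set p1 := pr (open_site 0 `&` _) in A1; set p0 := pr (_ `\` _) in A0.
have E01 : pr (open_nbrs 0) = p1 + p0 by rewrite (@probID _ _ _ P _ (open_site 0)) // setIC.
exists (p1 / p0); first exact: divr_gt0.
move=> A z zA zNA; have [_ z0 sA] := shell_centresP _ _ zA.
have nA u : adj z u -> u \in A by move=> /neighbour_shell/(fsubsetP sA).
pose S : seq (site d) := [seq y <- (A `|` outer_boundary A)%fset | (y != z) && ~~ adj z y].
have zS : z \notin S by rewrite mem_filter eqxx.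
have nS y : y \in S -> ~~ adj z y by rewrite mem_filter => /andP[/andP[]].
have bd y : y != z -> (y \in outer_boundary (z |` A)%fset) ->
    y \in outer_boundary A.
  move=> yz /outer_boundaryP[]; rewrite in_fset1U negb_or => /andP[_ yA] [x].
  rewrite in_fset1U => /orP[/eqP ->|xA] xy; last by apply/outer_boundaryP; split=> //; exists x.
  by rewrite nA in yA.
pose B : set (Omega d q) := cylinder S (cluster_pattern A).
have ev1 : cluster_event (z |` A)%fset = open_site z `&` B `&` open_nbrs z.
  apply/seteqP; split=> w.
    case/cluster_eventP => H1 H2; split; first split.
    - by apply: H1; rewrite in_fset1U eqxx.
    - move=> y; rewrite mem_filter in_fsetU /cluster_pattern => /andP[/andP[yz yn]].
      have [yA _|yA /= yb] := boolP (y \in A); first by rewrite H1 // in_fset1U yA orbT.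
      apply/eqP; apply: H2; case/outer_boundaryP: yb => _ [x xA xy].
      apply/outer_boundaryP; rewrite in_fset1U negb_or yz yA; split=> //.
      by exists x => //; rewrite in_fset1U xA orbT.
    - by move=> y; rewrite in_neighbours => /nA yA; rewrite H1 // in_fset1U yA orbT.
  case=> -[wz HB] HN; apply/cluster_eventP; split=> y.
    rewrite in_fset1U => /orP[/eqP -> //|yA]; have [zy|zy] := boolP (adj z y).
      by have := HN y; rewrite in_neighbours zy => /(_ isT)/eqP.
    have := HB y; rewrite mem_filter in_fsetU /cluster_pattern yA zy /= andbT.
    rewrite (_ : y != z) /=; first by move=> /(_ isT)/eqP.
    by apply: contraNneq zNA => <-.
  move=> yb; have yz : y != z.
    by case/outer_boundaryP: yb; rewrite in_fset1U negb_or => /andP[].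
  have yb' := bd y yz yb; have yA : y \notin A by case/outer_boundaryP: yb'.
  have := HB y; rewrite mem_filter in_fsetU yb' orbT /cluster_pattern (negbTE yA) yz.
  rewrite (_ : ~~ adj z y); first by move=> /(_ isT)/eqP.
  by apply: contra yA; exact: nA.
have zb : z \in outer_boundary A.
  apply/outer_boundaryP; split=> //; pose p : 'I_d * bool := (Ordinal hd, true).
  have zp : adj z (z + unit_step p) by apply/adjP; exists p.
  by exists (z + unit_step p); [exact: nA|rewrite adj_sym].
have ev0 : cluster_event A = (B `&` open_nbrs z) `\` open_site z.
  apply/seteqP; split=> w.
    case/cluster_eventP => H1 H2; split; last exact: H2.
    split=> y; last by rewrite in_neighbours => /nA yA; rewrite H1.
    rewrite mem_filter in_fsetU /cluster_pattern => /andP[_].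
    by case: ifP => [yA _|_ /=]; [rewrite H1|move/H2/eqP].
  case=> -[HB HN] wz; apply/cluster_eventP; split=> y yA.
    have [zy|zy] := boolP (adj z y).
      by have := HN y; rewrite in_neighbours zy => /(_ isT)/eqP.
    have := HB y; rewrite mem_filter in_fsetU /cluster_pattern yA zy /= andbT.
    rewrite (_ : y != z) /=; first by move=> /(_ isT)/eqP.
    by apply: contraNneq zNA => <-.
  have [-> //|yz] := eqVneq y z.
  have yA' : y \notin A by case/outer_boundaryP: yA.
  have := HB y; rewrite mem_filter in_fsetU yA orbT /cluster_pattern (negbTE yA') yz.
  rewrite (_ : ~~ adj z y); first by move=> /(_ isT)/eqP.
  by apply: contra yA'; exact: nA.
have mB : measurable B by exact: measurable_cylinder.
have [t1 t2] := shift_open_nbrs z T.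
have := markov_site (cluster_pattern A) M zS nS; rewrite -/B t1 t2 -/p1 E01 => MK.
have e3 : (B `&` open_nbrs z) `&` open_site z = cluster_event (z |` A)%fset.
  by rewrite ev1 [LHS]setIC setIA.
have := @probID _ _ _ P (B `&` open_nbrs z) (open_site z).
rewrite -ev0 e3 => /(_ (measurableI _ _ mB (measurable_open_nbrs z)) (measurable_open_site z)) SUM.
move: MK; rewrite -ev1 SUM => MK; rewrite /weight.
have p00 : p0 != 0 by rewrite gt_eqF.
apply: (mulIf p00); rewrite mulrAC mulfVK //; move: MK; set a := pr _; set b := pr _; lra.
Qed.

End ShellMarkov.

(** * Detailed balance between cluster sizes *)

(** Multiplicities in s are harmless, as the summands there are nonnegative. *)
Lemma ler_sum_inj (R : numDomainType) (I J : eqType) (r : seq I) (s : seq J)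
    (f : I -> J) (F : I -> R) (G : J -> R) :
  uniq r -> {in r &, injective f} -> (forall i, i \in r -> f i \in s) ->
  (forall i, i \in r -> F i <= G (f i)) -> (forall j, j \in s -> 0 <= G j) ->
  \sum_(i <- r) F i <= \sum_(j <- s) G j.
Proof.
elim: r s => [|i r IHr] s /=.
  move=> _ _ _ _ G0; rewrite big_nil big_seq; exact: sumr_ge0.
case/andP=> ir ur finj fs FG G0.
have fis : f i \in s by apply: fs; rewrite inE eqxx.
rewrite big_cons (perm_big _ (perm_to_rem fis)) /= big_cons.
apply: lerD; first by apply: FG; rewrite inE eqxx.
apply: IHr => //.
- by move=> a b ar br; apply: finj; rewrite inE ?ar ?br orbT.
- move=> a ar; have := fs a; rewrite inE ar orbT => /(_ isT).
  rewrite (perm_mem (perm_to_rem fis)) inE => /orP[/eqP e|//].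
  by move: ir; rewrite -(finj _ _ _ _ e) ?ar // inE ?eqxx ?ar ?orbT.
- by move=> a ar; apply: FG; rewrite inE ar orbT.
- by move=> j /mem_rem; exact: G0.
Qed.

Section Counting.
Local Open Scope fset_scope.
Local Open Scope classical_set_scope.
Local Open Scope ring_scope.
Variables (R : realType) (d q : nat) (P : probability (Omega d q) R).
Hypotheses (hd : (1 < d)%N).
Implicit Types (x y z : site d) (A B : {fset site d}).

(** The ball makes this a finite family; by [animal_ball] it excludes nothing. *)
Definition animals_upto n : {fset {fset site d}} :=
  [fset A in fpowerset (graph_ball d n) | `[< animal A >] && (#|` A| <= n)%N].

Lemma animals_uptoP n A :
  reflect (animal A /\ (#|` A| <= n)%N) (A \in animals_upto n).
Proof.
rewrite !inE /= fpowersetE; apply: (iffP andP) => [[_ /andP[/asboolP]]|[aA An]] //.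
by split; [exact: animal_ball | rewrite An andbT; exact/asboolP].
Qed.

Definition animals n : {fset {fset site d}} := [fset A in animals_upto n | #|` A| == n].

Lemma animalsP n A : reflect (animal A /\ #|` A| = n) (A \in animals n).
Proof.
rewrite in_fset inE /=; apply: (iffP andP) => [[/animals_uptoP[aA _] /eqP]|[aA An]] //.
by split; [apply/animals_uptoP; rewrite An | apply/eqP].
Qed.

Lemma cluster_event_cluster A (w : Omega d q) : animal A ->
  cluster_event A w -> occ_cluster w 0 = [set` A].
Proof.
move=> aA /cluster_eventP[H1 H2]; apply/seteqP.
have AS : {subset A <= occupied w} by move=> y /H1 wy; apply/eqP.
have bS y : y \in outer_boundary A -> ~~ occupied w y by move=> /H2 wy; apply/eqP.
by split=> y /=; have [H H'] := animal_component aA AS bS y.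
Qed.

Lemma prob_bigcup_animals (X : {fset {fset site d}}) :
  (forall A, A \in X -> animal A) ->
  prob P (\bigcup_(A in [set` X]) cluster_event A) = \sum_(A <- X) weight P A.
Proof.
move=> aX; apply: EFin_inj; rewrite -probE; last first.
  apply: fin_bigcup_measurable => // A _; exact: measurable_cluster_event.
rewrite measure_fin_bigcup //.
- rewrite -fsbig_seq ?fset_uniq // -sumEFin; apply: eq_bigr => A _.
  by rewrite /weight -probE //; exact: measurable_cluster_event.
- move=> A B /= AX BX [w [/(cluster_event_cluster (aX A AX)) e1
     /(cluster_event_cluster (aX B BX)) e2]].
  by apply/fsetP => y; have := congr1 (fun S => S y) (etrans (esym e1) e2) => /= /propeqP[]; 
    case: (y \in A); case: (y \in B) => // H1 H2; [rewrite H1|rewrite H2].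
- move=> A _; exact: measurable_cluster_event.
Qed.

Lemma sum_weight_le1 (X : {fset {fset site d}}) :
  (forall A, A \in X -> animal A) -> \sum_(A <- X) weight P A <= 1.
Proof.
move=> aX; rewrite -prob_bigcup_animals //; apply: prob_le1.
apply: fin_bigcup_measurable => // A _; exact: measurable_cluster_event.
Qed.

Lemma prob_sizeE n : (0 < n)%N -> prob_size P n = \sum_(A <- animals n) weight P A.
Proof.
move=> n0; rewrite -prob_bigcup_animals => [|A /animalsP[]//]; congr (fine (P _)).
apply/seteqP; split=> w /=; last first.
  case=> A /= /animalsP[aA An] /(cluster_event_cluster aA) ->.
  by apply/card_eq_fsetP.
move=> Cn; have fC : finite_set (occ_cluster w 0) by apply/finite_setP; exists n.
pose A := fset_set (occ_cluster w 0); have An : #|` A| = n by exact: card_fset_set.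
have CA y : reach (occupied w) 0 y <-> y \in A.
  by rewrite in_fset_set // inE.
have A0 : A != fset0 by rewrite -cardfs_gt0 An.
have [aA AS bS] := component_animal A0 CA.
exists A => /=; first exact/animalsP.
apply/cluster_eventP; split=> y; first by move/AS/eqP.
by move/bS/eqP.
Qed.

Definition open_centres A : {fset site d} := (shell_centres A `&` A)%fset.
Definition closed_centres A : {fset site d} := (shell_centres A `\` A)%fset.

Lemma card_open_closed A : (#|` open_centres A| + #|` closed_centres A| = #|` shell_centres A|)%N.
Proof. exact: cardfsID. Qed.

Lemma toggle_card A z : z \in closed_centres A ->
  [/\ #|` z |` A|%fset = #|` A|.+1, #|` open_centres (z |` A)%fset| = #|` open_centres A|.+1
    & #|` closed_centres (z |` A)%fset| = #|` closed_centres A|.-1].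
Proof.
rewrite in_fsetD => /andP[zNA zA]; have sE := shells_toggle zA.
split.
- by rewrite cardfsU1 zNA.
- rewrite (_ : open_centres _ = z |` open_centres A)%fset; first by rewrite cardfsU1 in_fsetI zA (negbTE zNA).
  apply/fsetP => u; rewrite !in_fsetI sE !in_fset1U in_fsetI.
  by case: eqP => // ->; rewrite zA.
- rewrite (_ : closed_centres _ = closed_centres A `\ z)%fset.
    by rewrite [in RHS](cardfsD1 z (closed_centres A)) in_fsetD zA zNA.
  by apply/fsetP => u; rewrite in_fsetD1 !in_fsetD sE in_fset1U negb_or andbA.
Qed.

Definition shell_moment n (phi : nat -> nat -> R) : R :=
  \sum_(A <- animals n) weight P A * phi #|` open_centres A| #|` closed_centres A|.

Lemma pair_uniq (I J : choiceType) (X : {fset I}) (Y : I -> {fset J}) :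
  uniq [seq (i, j) | i <- X, j <- Y i].
Proof.
apply: allpairs_uniq_dep; rewrite ?fset_uniq //.
by move=> [a b] [a' b'] _ _ /= [-> ->].
Qed.

Lemma mem_pair (I J : choiceType) (X : {fset I}) (Y : I -> {fset J}) i j :
  ((i, j) \in [seq (i, j) | i <- X, j <- Y i]) = (i \in X) && (j \in Y i).
Proof.
apply/allpairsPdep/andP => [[a [b [aX bY [-> ->]]]] //|[iX jY]].
by exists i, j.
Qed.

(** Both sides are sums over pairs of a cluster and one of its shell centres,
    and (A, z) |-> (z |` A, z) is a bijection between the two families of
    pairs, since opening z changes neither the other shell centres nor their
    states. *)
Lemma detailed_balance lam :
  (forall A z, z \in shell_centres A -> z \notin A -> weight P (z |` A)%fset = lam * weight P A) ->
  forall n phi,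
  shell_moment n.+1 (fun j e => j%:R * phi j e) =
  lam * shell_moment n (fun j e => e%:R * phi j.+1 e.-1).
Proof.
move=> Hlam n phi.
pose F (p : {fset site d} * site d) := weight P p.1 * phi #|` open_centres p.1| #|` closed_centres p.1|.
pose G (p : {fset site d} * site d) :=
  lam * (weight P p.1 * phi #|` open_centres p.1|.+1 #|` closed_centres p.1|.-1).
have -> : shell_moment n.+1 (fun j e => j%:R * phi j e) =
    \sum_(p <- [seq (A, z) | A <- animals n.+1, z <- open_centres A]) F p.
  rewrite big_allpairs_dep; apply: eq_bigr => A _ /=.
  rewrite /F /= big_const_seq count_predT iter_addr_0 -mulr_natl; ring.
have -> : lam * shell_moment n (fun j e => e%:R * phi j.+1 e.-1) =
    \sum_(p <- [seq (A, z) | A <- animals n, z <- closed_centres A]) G p.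
  rewrite big_allpairs_dep mulr_sumr; apply: eq_bigr => A _ /=.
  rewrite /G /= big_const_seq count_predT iter_addr_0 -mulr_natl; ring.
pose f (p : {fset site d} * site d) := ((p.2 |` p.1)%fset, p.2).
rewrite (perm_big (map f [seq (A, z) | A <- animals n, z <- closed_centres A])).
  rewrite big_map big_seq [RHS]big_seq; apply: eq_bigr => -[A z].
  rewrite mem_pair => /andP[_ zE]; have [_ e1 e2] := toggle_card zE.
  rewrite /F /G /f /= e1 e2 Hlam -?mulrA //.
    by move: zE; rewrite in_fsetD => /andP[].
  by move: zE; rewrite in_fsetD => /andP[].
rewrite perm_sym; apply: uniq_perm; rewrite ?pair_uniq //.
  rewrite map_inj_in_uniq ?pair_uniq // => -[A z] [B y].
  rewrite !mem_pair !in_fsetD => /andP[_ /andP[zA _]] /andP[_ /andP[yB _]] [/= e zy].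
  rewrite -{y}zy in e yB *; congr pair; apply/fsetP => u; move/fsetP/(_ u): e.
  by rewrite !in_fset1U; case: eqP => // -> _; rewrite (negbTE zA) (negbTE yB).
case=> A z; apply/mapP/idP => [[[B y]]|].
  rewrite mem_pair => /andP[/animalsP[aB Bn] yE] [-> ->].
  have [c1 _ _] := toggle_card yE; move: yE; rewrite in_fsetD => /andP[yB ys].
  rewrite mem_pair in_fsetI shells_toggle // ys fset1U1 !andbT.
  by apply/animalsP; split; [apply/(animal_toggle hd ys yB)|rewrite c1 Bn].
rewrite mem_pair in_fsetI => /andP[/animalsP[aA An] /andP[zs zA]].
have zAz : z \notin (A `\ z)%fset by rewrite in_fsetD1 eqxx.
have zs' : z \in shell_centres (A `\ z)%fset by rewrite shells_toggleD.
exists ((A `\ z)%fset, z); last by rewrite /f /= fsetD1K.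
rewrite mem_pair in_fsetD zAz zs' !andbT; apply/animalsP; split.
  by apply/(animal_toggle hd zs' zAz); rewrite fsetD1K.
by move: An; rewrite (cardfsD1 z) zA => -[].
Qed.

End Counting.

(** * Large clusters have linearly many shells *)

Section Pattern.
Local Open Scope fset_scope.
Local Open Scope classical_set_scope.
Local Open Scope ring_scope.
Variables (R : realType) (d q : nat) (P : probability (Omega d q) R).
Implicit Types (x y z : site d) (A B : {fset site d}).

Definition few_shelled n N m : {fset {fset site d}} :=
  [fset A in animals_upto d N | (n <= #|` A|)%N && (#|` shell_centres A| <= m)%N].

Lemma few_shelledP n N m A : reflect
  [/\ animal A, (#|` A| <= N)%N, (n <= #|` A|)%N & (#|` shell_centres A| <= m)%N]
  (A \in few_shelled n N m).
Proof.
rewrite in_fset inE /=; apply: (iffP and3P) => [[/animals_uptoP[]]|[aA AN nA Am]] //.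
by split=> //; apply/animals_uptoP.
Qed.

Definition fillable A : {fset site d} :=
  ([fset anchor x | x in A] `\` ((0 : site d) |` shell_centres A))%fset.

(** At least n / 3^d tiles meet A; those with a shell centre and the tile of the
    origin are not fillable. *)
Lemma card_fillable n m A : (n <= #|` A|)%N -> (#|` shell_centres A| <= m)%N ->
  n%:R / (tile_size d)%:R - m.+1%:R <= #|` fillable A|%:R :> R.
Proof.
move=> nA sm.
have K0 : (0 < tile_size d)%N.
  by rewrite -(card_tile (0 : site d)) cardfs_gt0; apply/fset0Pn; exists 0; exact: mem_tile.
rewrite lerBlDr ler_pdivrMr ?ltr0n // -natrD -natrM ler_nat mulnC.
apply: leq_trans nA _; apply: leq_trans (card_anchors A) _; rewrite leq_mul2l; apply/orP; right.
rewrite -(cardfsID ((0 : site d) |` shell_centres A)%fset) addnC leq_add2l.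
apply: leq_trans (fsubset_leq_card (fsubsetIr _ _)) _.
by rewrite cardfsU1; case: (_ \notin _) => //=; rewrite ?add1n ?ltnS // ltnW.
Qed.

(** Each pair (A, z) is sent to A with the tile of z filled.  The result has at
    most m+1 shell centres, z being one of them, and A is recovered from the
    result, z and the trace of A on the tile; hence every animal arises at
    most (m+1) 2^(3^d) times. *)
Lemma fill_step : finite_energy P -> exists2 D : R, 0 < D & forall n N m,
  (n%:R / (tile_size d)%:R - m.+1%:R) * \sum_(A <- few_shelled n N m) weight P A <=
  D * m.+1%:R * \sum_(A <- few_shelled n (N + tile_size d) m.+1) weight P A.
Proof.
move=> /weight_fill[h h0 Hh].
pose C : R := (2 ^ tile_size d)%:R.
exists (h^-1 * C).
  by rewrite mulr_gt0 ?invr_gt0 // ltr0n expn_gt0.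
move=> n N m.
pose r := [seq (A, z) | A <- few_shelled n N m, z <- fillable A].
pose marks A : {fset site d * {fset site d}} :=
  [fset p | p in [seq (z, U) | z <- shell_centres A, U <- fpowerset (tile z)]].
pose s := [seq (A, p) | A <- few_shelled n (N + tile_size d) m.+1, p <- marks A].
have marksP A z U : ((z, U) \in marks A) = (z \in shell_centres A) && (U `<=` tile z)%fset.
  by rewrite in_fset mem_pair fpowersetE.
have card_marks A : #|` marks A| = (#|` shell_centres A| * 2 ^ tile_size d)%N.
  rewrite card_fseq undup_id ?pair_uniq // size_allpairs_dep.
  rewrite (eq_map (g := fun=> (2 ^ tile_size d)%N)); last first.
    by move=> z; rewrite card_fpowerset card_tile.
  by rewrite sumnE big_map big_const_seq count_predT iter_addn_0 mulnC.
apply: (@le_trans _ _ (\sum_(p <- r) weight P p.1)).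
  rewrite big_allpairs_dep mulr_sumr big_seq [leRHS]big_seq; apply: ler_sum => A.
  case/few_shelledP => aA AN nA Am.
  rewrite /= big_const_seq count_predT iter_addr_0 -[leRHS]mulr_natl.
  by apply: ler_wpM2r; [exact: weight_ge0 | exact: card_fillable].
apply: (@le_trans _ _ (\sum_(p <- s) h^-1 * weight P p.1)); last first.
  rewrite big_allpairs_dep mulr_sumr big_seq [leRHS]big_seq; apply: ler_sum => A.
  case/few_shelledP => aA AN nA Am.
  rewrite /= big_const_seq count_predT iter_addr_0 -[leLHS]mulr_natl card_marks natrM.
  rewrite mulrA; apply: ler_wpM2r; first exact: weight_ge0.
  rewrite -/C [leLHS]mulrC [_ * C]mulrC mulrA; apply: ler_wpM2l; last by rewrite ler_nat.
  by rewrite mulr_ge0 ?invr_ge0 ?ltW ?ltr0n ?expn_gt0.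
pose f (p : {fset site d} * site d) :=
  ((p.1 `|` tile p.2)%fset, (p.2, (p.1 `&` tile p.2)%fset)).
apply: (@ler_sum_inj _ _ _ r s f).
- exact: pair_uniq.
- move=> [A z] [B y] _ _ [/= eU zy eI]; rewrite -{y}zy in eU eI *; congr pair.
  apply/fsetP => u; move/fsetP/(_ u): eU; move/fsetP/(_ u): eI.
  by rewrite !in_fsetI !in_fsetU; case: (u \in tile z); rewrite ?andbT ?orbF.
- move=> [A z]; rewrite mem_pair => /andP[/few_shelledP[aA AN nA Am]].
  rewrite in_fsetD in_fset1U negb_or => /andP[/andP[z0 zs] zc].
  rewrite mem_pair /= marksP shells_fill // fset1U1 fsubsetIr !andbT.
  apply/few_shelledP; split.
  + exact: animal_fill.
  + rewrite cardfsU card_tile; apply: leq_trans (leq_subr _ _) _.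
    by rewrite leq_add2r.
  + by apply: leq_trans nA _; apply: fsubset_leq_card; exact: fsubsetUl.
  + by rewrite shells_fill // cardfsU1 zs add1n ltnS.
- by move=> [A z] _ /=; rewrite ler_pdivlMl.
- by move=> p _; rewrite mulr_ge0 ?invr_ge0 ?weight_ge0 // ltW.
Qed.

(** As long as m is small compared with n, [fill_step] halves the sum each time
    that m increases by one.  The size bound N grows, which does not matter
    since all the sums are at most 1. *)
Lemma few_shelled_small : finite_energy P -> exists2 L, (0 < L)%N & forall n i N m,
  ((m + i) * L <= n)%N -> \sum_(A <- few_shelled n N m) weight P A <= (2^-1) ^+ i.
Proof.
move=> /fill_step[D D0 HD].
have K0 : (0 < tile_size d)%N.
  by rewrite -(card_tile (0 : site d)) cardfs_gt0; apply/fset0Pn; exists 0; exact: mem_tile.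
pose K := tile_size d; pose c := Num.truncn (2 * D).
have Dc : 2 * D <= c.+1%:R by rewrite ltW // truncnS_gt.
exists (K * c.+2)%N; first by rewrite muln_gt0 K0.
move=> n; elim=> [|i IHi] N m Hm.
  rewrite expr0; apply: sum_weight_le1 => A; by case/few_shelledP.
have := IHi (N + tile_size d)%N m.+1; rewrite addSnnS => /(_ Hm) H1.
have := HD n N m; set a := \sum_(A <- _) _ => HDm.
set b := \sum_(A <- few_shelled _ _ m.+1) _ in H1 HDm.
have b0 : 0 <= b by apply: sumr_ge0 => A _; exact: weight_ge0.
have a0 : 0 <= a by apply: sumr_ge0 => A _; exact: weight_ge0.
have Hn : m.+1%:R * c.+2%:R <= n%:R / K%:R :> R.
  rewrite ler_pdivlMr ?ltr0n // -!natrM ler_nat; apply: leq_trans Hm.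
  by rewrite -mulnA (mulnC c.+2); apply: leq_mul => //; rewrite addnS ltnS leq_addr.
rewrite exprS; apply: le_trans (_ : 2^-1 * b <= _); last by rewrite ler_pM2l // invr_gt0 ltr0n.
have m0 : 0 < m.+1%:R :> R by rewrite ltr0n.
have H2 : m.+1%:R * c.+1%:R * a <= D * m.+1%:R * b.
  apply: le_trans HDm; apply: ler_wpM2r => //.
  move: Hn; rewrite -[c.+2]addn1 natrD -/K; lra.
have H3 : m.+1%:R * (2 * D * a) <= m.+1%:R * (D * b).
  apply: le_trans (_ : m.+1%:R * c.+1%:R * a <= _).
    by rewrite -[leRHS]mulrA ler_pM2l //; apply: ler_wpM2r.
  by apply: le_trans H2 _; rewrite mulrCA mulrA.
move: H3; rewrite ler_pM2l // -mulrA (mulrCA 2) ler_pM2l // => H3; lra.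
Qed.

Lemma few_shells : finite_energy P -> exists2 L, (0 < L)%N & forall n k, (k * L <= n)%N ->
  \sum_(A <- animals d n | (#|` shell_centres A| <= k)%N) weight P A <= (2^-1) ^+ k.
Proof.
move=> /few_shelled_small[L L0 H]; exists (2 * L)%N; first by rewrite muln_gt0.
move=> n k kL; apply: le_trans (H n k n k _); last by rewrite addnn -muln2 -mulnA.
rewrite -big_filter; apply: (@ler_sum_inj _ _ _ _ _ id) => //.
- by rewrite filter_uniq // fset_uniq.
- move=> A; rewrite mem_filter => /andP[sA /animalsP[aA An]].
  by apply/few_shelledP; rewrite An.
- by move=> A _; exact: weight_ge0.
Qed.

End Pattern.

(** * Consecutive sizes under detailed balance *)

Section Ratio.
Variable R : realFieldType.

(** Abstracts the moments of the pair (number of centres in one state, number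
    in the other state), so that the argument below serves both for closing
    and for opening centres. *)
Definition positive_functional (E : (nat -> nat -> R) -> R) :=
  [/\ forall phi psi, (forall x y, phi x y <= psi x y) -> E phi <= E psi,
      forall c phi, E (fun x y => c * phi x y) = c * E phi
    & forall phi psi, E (fun x y => phi x y + psi x y) = E phi + E psi].

Variables (F : nat -> (nat -> nat -> R) -> R) (l : R) (t : nat).
Hypothesis Fpos : forall i, positive_functional (F i).
Hypothesis Fbal : forall i phi, (i <= t)%N ->
  F i (fun x y => x%:R * phi x y) = l * F i.+1 (fun x y => y%:R * phi x.+1 y.-1).

Variables (dl B : R).
Hypotheses (l0 : 0 < l) (dl0 : 0 < dl) (dl1 : dl <= 1).
Hypothesis tB : (1 + l) * t%:R <= dl / 2 * (l / (1 + l) * B - t%:R).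

(** After i steps the original pair is (x + i, y - i), and the imbalance is
    always that of the original pair. *)
Definition unbalanced (i x y : nat) : bool :=
  (l * (y%:R - i%:R) < (1 - dl) * (x%:R + i%:R + 1)) && (B <= x%:R + y%:R).

Lemma unbalanced_lb i x y : (i <= t)%N -> unbalanced i x y ->
  l / (1 + l) * B - t%:R < x%:R + 1.
Proof.
have [lp dp dle] : [/\ 0 < l, 0 < dl & dl <= 1] by [].
move=> it /andP[H1 H2].
have it' : i%:R <= t%:R :> R by rewrite ler_nat.
have x0 : 0 <= x%:R :> R by exact: ler0n.
have i0 : 0 <= i%:R :> R by exact: ler0n.
have e : (1 - dl) * (x%:R + i%:R + 1) <= x%:R + i%:R + 1 :> R.
  have : 0 <= dl * (x%:R + i%:R + 1) by rewrite mulr_ge0 ?addr_ge0 // ltW.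
  lra.
have l1 : 0 < 1 + l by lra.
rewrite ltrBlDr mulrAC ltr_pdivrMr //.
have H3 : l * B <= l * (x%:R + y%:R) by rewrite ler_pM2l.
have H4 : l * i%:R <= l * t%:R by rewrite ler_pM2l.
nra.
Qed.

(** Apply the balance identity to the indicator divided by x.  After the step
    the factor l y / (x+1) appears; it is at most 1 - dl/2 because the
    imbalance is still visible after at most t steps. *)
Lemma unbalanced_step i : (i < t)%N ->
  F i.+1 (fun x y => (unbalanced i x y)%:R) <=
  (1 - dl / 2) * F i.+2 (fun x y => (unbalanced i.+1 x y)%:R).
Proof.
have [lp dp dle] : [/\ 0 < l, 0 < dl & dl <= 1] by [].
move=> it; have [mono scal add] := Fpos i.+1; have [mono' scal' add'] := Fpos i.+2.
have t1 : 1 <= t%:R :> R by rewrite ler1n; apply: leq_trans it.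
have LB : 2 <= l / (1 + l) * B - t%:R.
  set b := _ - _; have H : (1 + l) * t%:R <= dl / 2 * b by exact: tB.
  have H1 : 1 <= (1 + l) * t%:R by nra.
  have b0 : 0 <= b by rewrite -(pmulr_rge0 _ (_ : 0 < dl / 2)); lra.
  nra.
apply: le_trans (_ : F i.+1 (fun x y => x%:R * (x%:R^-1 * (unbalanced i x y)%:R)) <= _).
  apply: mono => x y; case H : (unbalanced i x y); rewrite ?mulr0 // mulr1 mulfV //.
  have H1 := unbalanced_lb (ltnW it) H.
  by rewrite pnatr_eq0; apply/eqP => x0; move: H1; rewrite x0; lra.
rewrite Fbal // -scal' -scal'; apply: mono' => -x y.
case: y => [|y] /=; first by rewrite mul0r mulr0 mulr_ge0 //; lra.
have -> : unbalanced i x.+1 y = unbalanced i.+1 x y.+1.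
  rewrite /unbalanced; congr (_ && _).
    by rewrite -!natr1; congr (_ < _); ring.
  by rewrite -!natr1; congr (_ <= _); ring.
case H : unbalanced; rewrite ?mulr0 // !mulr1 mulrA ler_pdivrMr ?ltr0n //.
have H1 := unbalanced_lb it H; case/andP: H => H2 _; move: H2.
set b := _ - t%:R in H1 *; have tb : (1 + l) * t%:R <= dl / 2 * b by exact: tB.
have it' : i.+1%:R <= t%:R :> R by rewrite ler_nat.
rewrite -[x.+1%:R]natr1 => H2.
have H3 : dl / 2 * b <= dl / 2 * (x%:R + 1) by rewrite ler_pM2l; lra.
have i0 : 0 <= i.+1%:R :> R by exact: ler0n.
have H4 : l * i.+1%:R <= l * t%:R by rewrite ler_pM2l.
nra.
Qed.

Lemma unbalanced_small :
  F 1 (fun x y => (unbalanced 0 x y)%:R) <= (1 - dl / 2) ^+ t * F t.+1 (fun _ _ => 1).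
Proof.
have [lp dp dle] : [/\ 0 < l, 0 < dl & dl <= 1] by [].
have r0 : 0 <= 1 - dl / 2 by lra.
have H i : (i <= t)%N -> F 1 (fun x y => (unbalanced 0 x y)%:R) <=
    (1 - dl / 2) ^+ i * F i.+1 (fun x y => (unbalanced i x y)%:R).
  elim: i => [|i IHi] it; first by rewrite expr0 mul1r.
  apply: le_trans (IHi (ltnW it)) _; rewrite exprSr -mulrA ler_wpM2l ?exprn_ge0 //.
  exact: unbalanced_step.
apply: le_trans (H t (leqnn t)) _; rewrite ler_wpM2l ?exprn_ge0 //.
by have [mono _ _] := Fpos t.+1; apply: mono => x y; case: unbalanced; rewrite ?ler01.
Qed.

(** The identity applied to phi = 1/x turns the total mass of [F 0] into the
    mean of l y / (x+1) under [F 1], which is at least 1 - dl off the pairs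
    with few centres and the unbalanced ones. *)
Lemma balance_ratio :
  (1 - dl) * (F 1 (fun _ _ => 1) - F 1 (fun x y => (x%:R + y%:R < B)%R%:R)
              - (1 - dl / 2) ^+ t * F t.+1 (fun _ _ => 1))
  <= F 0 (fun _ _ => 1).
Proof.
have [lp dp dle] : [/\ 0 < l, 0 < dl & dl <= 1] by [].
have [mono scal add] := Fpos 0; have [mono' scal' add'] := Fpos 1.
apply: le_trans (_ : F 0 (fun x y => x%:R * x%:R^-1) <= _); last first.
  apply: mono => x y; have [->|x0] := eqVneq x 0%N; first by rewrite mul0r.
  by rewrite mulfV // pnatr_eq0.
rewrite Fbal // -scal'.
have d0 : 0 <= 1 - dl by lra.
apply: le_trans (_ : (1 - dl) * F 1 (fun x y => 1 + ((-1) * (x%:R + y%:R < B)%R%:R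
     + (-1) * (unbalanced 0 x y)%:R)) <= _).
  rewrite ler_wpM2l // !add' !scal'; have := unbalanced_small; lra.
rewrite -scal'; apply: mono' => x y.
have x0 : 0 < x.+1%:R :> R by rewrite ltr0n.
have P0 : 0 <= l * (y%:R * x.+1%:R^-1).
  by rewrite mulr_ge0 ?mulr_ge0 ?invr_ge0 // ltW.
have [xyB|xyB] := ltP (x%:R + y%:R) B.
  apply: le_trans P0; rewrite -[leRHS](mulr0 (1 - dl)) ler_wpM2l //.
  by case: unbalanced => /=; lra.
rewrite /unbalanced xyB andbT !subr0 !addr0 mulr0 add0r.
case: ltP => H /=; first by apply: le_trans P0; rewrite mulr1 subrr mulr0.
by rewrite mulr0 addr0 mulr1 mulrA ler_pdivlMr // -natr1.
Qed.

End Ratio.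

(** * Stretched exponential estimates *)

Section Analysis.
Variable R : realType.

Lemma near_powR_ge (s M : R) : 0 < s -> \forall n \near \oo, M <= n%:R `^ s.
Proof.
move=> s0; pose M0 := Num.max M 0.
have M00 : 0 <= M0 by rewrite le_max lexx orbT.
near=> n.
apply: (@le_trans _ _ M0); first by rewrite le_max lexx.
rewrite (_ : M0 = (M0 `^ s^-1) `^ s); last by rewrite -powRrM mulVf ?lt0r_neq0 // powRr1.
apply: (ge0_ler_powR (ltW s0)); rewrite ?nnegrE ?powR_ge0 //.
by near: n; exact: nbhs_infty_ger.
Unshelve. all: by end_near. Qed.

(** For k = - ln nu this is the statement that a(n)^(1/n^beta) tends to nu,
    written as exponential bounds that can be multiplied. *)
Definition stretched_tail (a : nat -> R) (beta k : R) :=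
  forall th : R, 0 < th -> \forall n \near \oo,
    expR (- (k + th) * n%:R `^ beta) <= a n <= expR (- (k - th) * n%:R `^ beta).

Lemma stretched_tail_cvg (a : nat -> R) (beta nu : R) :
  0 < beta -> 0 < nu -> (forall n, 0 <= a n) ->
  a n `^ (n%:R `^ beta)^-1 @[n --> \oo] --> nu -> stretched_tail a beta (- ln nu).
Proof.
move=> b0 nu0 a0 cv th th0.
have e1 : expR (ln nu - th) < nu by rewrite -[ltRHS]lnK // ltr_expR; lra.
have e2 : nu < expR (ln nu + th) by rewrite -[ltLHS]lnK // ltr_expR; lra.
near=> n.
have n0 : 0 < n%:R `^ beta.
  by apply: powR_gt0; near: n; exact: nbhs_infty_gtr.
have aE : a n = (a n `^ (n%:R `^ beta)^-1) `^ (n%:R `^ beta).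
  by rewrite -powRrM mulVf ?lt0r_neq0 // powRr1.
have H1 : expR (ln nu - th) <= a n `^ (n%:R `^ beta)^-1.
  by near: n; exact: cvgr_ge cv _ e1.
have H2 : a n `^ (n%:R `^ beta)^-1 <= expR (ln nu + th).
  by near: n; exact: cvgr_le cv _ e2.
have e3 : - (- ln nu + th) = ln nu - th by rewrite opprD opprK.
have e4 : - (- ln nu - th) = ln nu + th by rewrite opprB opprK addrC.
rewrite aE e3 e4 !expRM; apply/andP; split;
  by apply: ge0_ler_powR; rewrite ?nnegrE ?expR_ge0 ?powR_ge0 // ltW.
Unshelve. all: by end_near. Qed.

(** With r = n^(beta/2) one has ln n = (2/beta) ln r <= (2/beta) r, whereas
    n^beta = r^2. *)
Lemma exp_beats_power (beta g A M : R) : 0 < beta -> 0 < g -> 0 < A ->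
  \forall n \near \oo, M * n%:R `^ g <= expR (A * n%:R `^ beta).
Proof.
move=> b0 g0 A0; near=> n.
have n0 : 0 < n%:R :> R by near: n; exact: nbhs_infty_gtr.
set x : R := n%:R in n0 *; pose r := x `^ (beta / 2).
have r0 : 0 < r by exact: powR_gt0.
have bE : x `^ beta = r * r by rewrite /r -powRD ?gt_eqF ?implybT // -splitr.
have H1 : x `^ g <= expR (A / 2 * (r * r)).
  have r1 : 2 * g / beta <= A / 2 * r.
    rewrite -ler_pdivrMl ?divr_gt0 //.
    by rewrite /r /x; near: n; apply: near_powR_ge; rewrite divr_gt0.
  rewrite -[leLHS]lnK ?posrE ?powR_gt0 // ler_expR ln_powR.
  have -> : ln x = 2 / beta * ln r.
    by rewrite /r ln_powR; field; rewrite gt_eqF.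
  have lr : ln r <= r by rewrite ltW // ln_sublinear.
  apply: le_trans (_ : g * (2 / beta * r) <= _).
    by rewrite ler_pM2l // ler_pM2l // divr_gt0.
  by rewrite (_ : g * (2 / beta * r) = 2 * g / beta * r) ?mulrA; [rewrite ler_pM2r|ring].
have H2 : M <= expR (A / 2 * (r * r)).
  apply: le_trans (expR_ge1Dx _); rewrite -bE.
  suff : M <= A / 2 * x `^ beta by lra.
  rewrite -ler_pdivrMl ?divr_gt0 //.
  by rewrite /x; near: n; exact: near_powR_ge.
rewrite bE (_ : A * (r * r) = A / 2 * (r * r) + A / 2 * (r * r)); last by field.
rewrite expRD; apply: le_trans (_ : expR (A / 2 * (r * r)) * x `^ g <= _).
  by rewrite ler_wpM2r // powR_ge0.
by rewrite ler_pM2l // expR_gt0.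
Unshelve. all: by end_near. Qed.

(** Put b = n^beta.  The product of (1 - dl/2)^t <= exp(1/2 - A b), where
    A = c eps^2 / 2, with a m <= exp(-(k - th)(1 - th) b) is compared with
    a m0 >= exp(-(k + th)(1 + th) b).  The number th is chosen so small that
    the quotient is at most exp(1/2 - A b / 2), which beats every power of n. *)
Lemma error_small (a : nat -> R) (c beta k eps : R) :
  0 < c -> 0 < beta < 1 -> 0 < k -> 0 < eps -> stretched_tail a beta k ->
  \forall n \near \oo,
    forall dl t m m0, dl = eps / n%:R `^ ((1 - beta) / 2) ->
    t = Num.truncn (c * dl * n%:R) -> (n <= m + t)%N -> (m0 == n) || (m0 == n.+1) ->
    expR (- c * n%:R) + (1 - dl / 2) ^+ t * a m <= dl * a m0.
Proof.
move=> c0 /andP[b0 b1] k0 eps0 tail.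
pose g := (1 - beta) / 2; have g0 : 0 < g by rewrite divr_gt0 // subr_gt0.
pose A := c * eps ^+ 2 / 2; have A0 : 0 < A by rewrite divr_gt0 // mulr_gt0 // exprn_gt0.
(* (k + th)(1 + th) - (k - th)(1 - th) = 2 (k + 1) th must not exceed A / 2. *)
pose th := Num.min (k / 2) (Num.min (2^-1) (A / (4 * (k + 1)))).
have th0 : 0 < th.
  by rewrite /th !lt_min !divr_gt0 ?invr_gt0 ?mulr_gt0 ?addr_gt0.
have [thk [th1 thA]] : th <= k / 2 /\ th <= 2^-1 /\ th <= A / (4 * (k + 1)).
  by rewrite /th !ge_min !lexx !orbT.
have {}thA : 4 * (k + 1) * th <= A.
  by move: thA; rewrite ler_pdivlMr ?mulr_gt0 ?addr_gt0 // mulrC.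
have u1 : 0 < 1 - th by lra.
have u2 : 0 < 1 + th by lra.
have u1' : 1 - th <= 1 by lra.
have u2' : 1 <= 1 + th by lra.
have kth : 0 < k - th by lra.
have kth' : 0 < k + th by lra.
have [N _ HN] := tail th th0.
pose C := (k + th) * (1 + th) + A / 2.
have E := @exp_beats_power beta g (A / 2) (2 * expR (2^-1) / eps) b0 g0 (divr_gt0 A0 (ltr0Sn _ 1)).
near=> n => dl t m m0 dlE0 tE nm Hm0.
have n0 : 0 < n%:R :> R by near: n; exact: nbhs_infty_gtr.
set x : R := n%:R in n0 *; pose gx := x `^ g; pose bx := x `^ beta.
have gx0 : 0 < gx by exact: powR_gt0.
have bx0 : 0 < bx by exact: powR_gt0.
have xE : x = gx * gx * bx.
  have gb : g + g + beta = 1 by rewrite /g; field.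
  have xD r s : x `^ r * x `^ s = x `^ (r + s).
    by rewrite powRD // (gt_eqF n0) implybT.
  by rewrite /gx /bx !xD gb powRr1 // ltW.
have dlE : dl = eps / gx by exact: dlE0.
have dl0 : 0 < dl by rewrite dlE divr_gt0.
have gx1 : 1 <= gx by rewrite /gx /x; near: n; exact: near_powR_ge.
have dl1 : dl <= 1.
  by rewrite dlE ler_pdivrMr // mul1r; rewrite /gx /x; near: n; exact: near_powR_ge.
have dlc : c * dl <= th.
  rewrite dlE mulrA ler_pdivrMr // -ler_pdivrMl //.
  by rewrite /gx /x; near: n; exact: near_powR_ge.
have gxC : C <= c * (gx * gx).
  apply: le_trans (_ : c * gx <= _); last by rewrite ler_pM2l // ler_peMr // ltW.
  by rewrite -ler_pdivrMl //; rewrite /gx /x; near: n; exact: near_powR_ge.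
have tx : t%:R <= c * dl * x by rewrite tE truncn_le !mulr_ge0 // ltW.
have tx' : t%:R <= th * x by apply: le_trans tx _; rewrite ler_pM2r.
have ts : c * dl * x - 1 <= t%:R by have := truncnS_gt (c * dl * x); rewrite -natr1 tE; lra.
have mx : (1 - th) * x <= m%:R.
  by move: nm; rewrite -(ler_nat R) natrD -/x; lra.
have xN : N%:R <= (1 - th) * x.
  rewrite -ler_pdivrMl //.
  by rewrite /x; near: n; exact: nbhs_infty_ger.
have Nm : (N <= m)%N by rewrite -(ler_nat R); apply: le_trans mx.
have nm0 : (n <= m0)%N by case/orP: Hm0 => /eqP ->.
have Nm0 : (N <= m0)%N.
  apply: leq_trans nm0; rewrite -(ler_nat R); apply: le_trans xN _.
  by rewrite ler_piMl // ltW.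
have thx : 1 <= th * x.
  by rewrite -ler_pdivrMl // mulr1; rewrite /x; near: n; exact: nbhs_infty_ger.
have m0x : m0%:R <= (1 + th) * x.
  by case/orP: Hm0 => /eqP ->; rewrite -?natr1 -/x; lra.
have /andP[aml am] := HN m Nm.
have am_ge0 := le_trans (expR_ge0 _) aml.
have /andP[am0 _] := HN m0 Nm0.
have x1 : 0 <= (1 - th) * x by rewrite mulr_ge0 // ltW.
have x2 : 0 <= (1 + th) * x by rewrite mulr_ge0 // ltW.
have mb : (1 - th) * bx <= m%:R `^ beta.
  apply: le_trans (_ : ((1 - th) * x) `^ beta <= _); last first.
    by apply: (ge0_ler_powR (ltW b0)); rewrite ?nnegrE.
  rewrite powRM ?(ltW n0) ?(ltW u1) // ler_pM2r //.
  by apply: ger1_powR; [rewrite u1 | exact: ltW].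
have m0b : m0%:R `^ beta <= (1 + th) * bx.
  apply: le_trans (_ : ((1 + th) * x) `^ beta <= _).
    by apply: (ge0_ler_powR (ltW b0)); rewrite ?nnegrE.
  rewrite powRM ?(ltW n0) ?(ltW u2) // ler_pM2r //.
  by apply: ler1_powR; last exact: ltW.
pose E0 := expR (- (k + th) * ((1 + th) * bx)).
have E00 : 0 < E0 by exact: expR_gt0.
have {}am0 : E0 <= a m0.
  by apply: le_trans am0; rewrite ler_expR !mulNr lerN2 ler_pM2l.
have {}am : a m <= expR (- (k - th) * ((1 - th) * bx)).
  by apply: le_trans am _; rewrite ler_expR !mulNr lerN2 ler_pM2l.
have e12 : 1 <= expR 2^-1 :> R by rewrite -expR0 ler_expR.
have Hexp : 2 * expR (2^-1) * expR (- (A / 2) * bx) <= dl.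
  rewrite mulNr expRN ler_pdivrMr ?expR_gt0 // dlE.
  rewrite mulrAC ler_pdivlMr // -ler_pdivrMl // mulrA [eps^-1 * _]mulrC.
  by rewrite /gx /bx /x; near: n.
have T1 : expR (- c * x) <= expR (2^-1) * expR (- (A / 2) * bx) * E0.
  apply: le_trans (_ : expR (- (A / 2) * bx) * E0 <= _); last first.
    by rewrite ler_pM2r // ler_peMl // expR_ge0.
  rewrite -expRD ler_expR xE !mulNr -opprD lerN2 mulrA -mulrDl.
  by rewrite (mulrA c) ler_pM2r // addrC.
have dlh : 0 <= 1 - dl / 2 by rewrite subr_ge0 ler_pdivrMr // mul1r (le_trans dl1) // ler1n.
have T2 : (1 - dl / 2) ^+ t * a m <= expR (2^-1) * expR (- (A / 2) * bx) * E0.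
  have P1 : (1 - dl / 2) ^+ t <= expR (2^-1 - A * bx).
    apply: le_trans (_ : expR (- (dl / 2)) ^+ t <= _).
      by apply: lerXn2r; rewrite ?nnegrE ?expR_ge0 ?expR_ge1Dx // dlh.
    rewrite -expRM_natl ler_expR.
    have -> : A * bx = dl / 2 * (c * dl * x).
      by rewrite dlE xE /A; field; rewrite gt_eqF.
    have H3 : dl / 2 * (c * dl * x - 1) <= dl / 2 * t%:R by rewrite ler_pM2l // divr_gt0.
    lra.
  apply: le_trans (_ : expR (2^-1 - A * bx) * expR (- (k - th) * ((1 - th) * bx)) <= _).
    by apply: ler_pM => //; exact: exprn_ge0.
  rewrite -!expRD ler_expR.
  have H4 : 4 * (k + 1) * th * bx <= A * bx by rewrite ler_pM2r.
  rewrite -subr_ge0; set rhs := (X in 0 <= X).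
  have -> : rhs = (A * bx - 4 * (k + 1) * th * bx) / 2 by rewrite /rhs; field.
  by rewrite divr_ge0 // subr_ge0.
apply: le_trans (_ : 2 * expR (2^-1) * expR (- (A / 2) * bx) * E0 <= _).
  by apply: le_trans (lerD T1 T2) _; rewrite -!mulrA mulr_natl mulr2n.
by apply: ler_pM => //; rewrite ?ltW // !mulr_ge0 ?expR_ge0.
Unshelve. all: by end_near. Qed.

End Analysis.

(** * From comparison to slow variation *)

Section SlowVariation.
Variable R : realType.
Implicit Types (a : nat -> R).

(** The combinatorial input of the analysis: the inequalities of
    [balance_ratio] for closing and for opening centres, with the clusters
    that have few shells bounded exponentially. *)
Definition two_sided_comparison a (c : R) (n : nat) := forall (dl : R) (t : nat),
  0 < dl <= 1 -> t%:R <= c * dl * n%:R ->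
  (1 - dl) * (a n - expR (- c * n%:R) - (1 - dl / 2) ^+ t * a (n - t)%N) <= a n.+1 /\
  (1 - dl) * (a n.+1 - expR (- c * n%:R) - (1 - dl / 2) ^+ t * a (n.+1 + t)%N) <= a n.

Definition slowly_varying a (g : R) := forall eps : R, 0 < eps ->
  \forall n \near \oo, [/\ 0 < a n, (1 - eps / n%:R `^ g) * a n <= a n.+1
    & (1 - eps / n%:R `^ g) * a n.+1 <= a n].

Lemma twice_le (dl u v w : R) : 0 < dl -> dl <= 1 -> 0 < u ->
  (1 - dl) * (u - w) <= v -> w <= dl * u -> (1 - 2 * dl) * u <= v.
Proof.
move=> dl0 dl1 u0 H1 H2; apply: le_trans H1.
apply: le_trans (_ : (1 - dl) * (u - dl * u) <= _).
  have : 0 <= dl * dl * u by rewrite !mulr_ge0 // ltW.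
  lra.
by rewrite ler_wpM2l ?subr_ge0 // lerB.
Qed.

Lemma ratio_near1 (u v s : R) : 0 < u -> 0 <= s -> 2 * s <= 1 ->
  (1 - s) * u <= v -> (1 - s) * v <= u -> `|v / u - 1| <= 2 * s.
Proof.
move=> u0 s0 s1 H1 H2; rewrite ler_distl; apply/andP; split.
  rewrite ler_pdivlMr //; apply: le_trans H1; rewrite ler_pM2r //; lra.
rewrite ler_pdivrMr //; have d1 : 0 < 1 - s by lra.
rewrite -(ler_pM2l d1); apply: le_trans H2 _.
have : 0 <= (s * (1 - 2 * s)) * u by rewrite !mulr_ge0 ?(ltW u0) // subr_ge0.
lra.
Qed.

Lemma comparison_slowly_varying a (c beta k : R) :
  0 < c -> 0 < beta < 1 -> 0 < k -> stretched_tail a beta k ->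
  (\forall n \near \oo, two_sided_comparison a c n) ->
  slowly_varying a ((1 - beta) / 2).
Proof.
move=> c0 b01 k0 tail cmp eps eps0; have /andP[b0 b1] := b01.
have g0 : 0 < (1 - beta) / 2 by rewrite divr_gt0 // subr_gt0.
have e20 : 0 < eps / 2 by rewrite divr_gt0.
have [N _ HN] := tail 1 ltr01.
near=> n.
have n0 : 0 < n%:R :> R by near: n; exact: nbhs_infty_gtr.
have nN : (N <= n)%N by near: n; exists N.
have gx_eps : eps / 2 <= n%:R `^ ((1 - beta) / 2) by near: n; exact: near_powR_ge.
have E : forall dl t m m0, dl = eps / 2 / n%:R `^ ((1 - beta) / 2) ->
    t = Num.truncn (c * dl * n%:R) -> (n <= m + t)%N -> (m0 == n) || (m0 == n.+1) ->
    expR (- c * n%:R) + (1 - dl / 2) ^+ t * a m <= dl * a m0.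
  by near: n; exact: error_small tail.
have C : two_sided_comparison a c n by near: n.
have gx0 : 0 < n%:R `^ ((1 - beta) / 2) :> R by exact: powR_gt0.
have apos m : (N <= m)%N -> 0 < a m.
  by move=> /HN/andP[H _]; exact: lt_le_trans (expR_gt0 _) H.
have an := apos _ nN; have an1 := apos _ (leqW nN).
pose dl := eps / 2 / n%:R `^ ((1 - beta) / 2).
have -> : eps / n%:R `^ ((1 - beta) / 2) = 2 * dl.
  by rewrite /dl; field; rewrite gt_eqF.
have dl0 : 0 < dl by rewrite divr_gt0.
have dl1 : dl <= 1 by rewrite ler_pdivrMr // mul1r.
pose t := Num.truncn (c * dl * n%:R).
have tb : t%:R <= c * dl * n%:R by rewrite truncn_le !mulr_ge0 // ltW.
have [|C1 C2] := C dl t _ tb; first by rewrite dl0.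
have E1 : expR (- c * n%:R) + (1 - dl / 2) ^+ t * a (n - t)%N <= dl * a n.
  by apply: (E dl t _ _ erefl erefl); rewrite ?eqxx // addnC -leq_subLR.
have E2 : expR (- c * n%:R) + (1 - dl / 2) ^+ t * a (n.+1 + t)%N <= dl * a n.+1.
  by apply: (E dl t _ _ erefl erefl); rewrite ?eqxx ?orbT // -addnA addSn -addnS leq_addr.
split=> //.
- by apply: twice_le dl0 dl1 an _ E1; apply: le_trans C1; rewrite opprD addrA.
- by apply: twice_le dl0 dl1 an1 _ E2; apply: le_trans C2; rewrite opprD addrA.
Unshelve. all: by end_near. Qed.

Lemma slowly_varying_ratio1 a (g eps : R) : 0 < g -> slowly_varying a g -> 0 < eps ->
  \forall n \near \oo, `|a n.+1 / a n - 1| <= eps / n%:R `^ g.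
Proof.
move=> g0 sv eps0; have e20 : 0 < eps / 2 by rewrite divr_gt0.
near=> n.
have gx0 : 0 < n%:R `^ g :> R.
  by apply: powR_gt0; near: n; exact: nbhs_infty_gtr.
have gx : eps <= n%:R `^ g by near: n; exact: near_powR_ge.
have [a0 H1 H2] : [/\ 0 < a n, (1 - eps / 2 / n%:R `^ g) * a n <= a n.+1
    & (1 - eps / 2 / n%:R `^ g) * a n.+1 <= a n] by near: n; exact: sv.
have e : eps / n%:R `^ g = 2 * (eps / 2 / n%:R `^ g) by field; rewrite gt_eqF.
rewrite e; apply: ratio_near1 => //; first by rewrite ltW // divr_gt0.
by rewrite -e ler_pdivrMr // mul1r.
Unshelve. all: by end_near. Qed.

(** Bernoulli's inequality, in product form. *)
Lemma slowly_varying_iter a (dl : R) n k :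
  0 < dl -> dl <= 1 -> (forall m, (n <= m)%N ->
    [/\ 0 < a m, (1 - dl) * a m <= a m.+1 & (1 - dl) * a m.+1 <= a m]) ->
  (1 - k%:R * dl) * a n <= a (n + k)%N /\ (1 - k%:R * dl) * a (n + k)%N <= a n.
Proof.
move=> dl0 dl1 H; elim: k => [|k [IH1 IH2]].
  by rewrite mul0r subr0 addn0 mul1r lexx.
have [ank H1 H2] := H (n + k)%N (leq_addr _ _); have [an _ _] := H n (leqnn _).
have [ank1 _ _] := H (n + k).+1 (leqW (leq_addr _ _)).
rewrite addnS -natr1; have d1 : 0 <= 1 - dl by rewrite subr_ge0.
have k0 : 0 <= k%:R :> R by [].
split.
- apply: le_trans H1; apply: le_trans (ler_wpM2l d1 IH1).
  have : 0 <= k%:R * dl * dl * a n by rewrite !mulr_ge0 // ltW.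
  lra.
- have [kd|kd] := lerP 0 (1 - k%:R * dl).
    apply: le_trans IH2; apply: le_trans (ler_wpM2l kd H2).
    have : 0 <= k%:R * dl * dl * a (n + k).+1 by rewrite !mulr_ge0 // ltW.
    lra.
  apply: le_trans (ltW an); rewrite mulr_le0_ge0 ?(ltW ank1) //; lra.
Qed.

Lemma slowly_varying_shift a (g x al : R) : 0 < g -> slowly_varying a g ->
  0 < x -> 0 < al <= g ->
  a (n + Num.truncn (x * n%:R `^ al))%N / a n @[n --> \oo] --> (1 : R).
Proof.
move=> g0 sv x0 /andP[al0 alg]; apply/cvgrPdist_le => eta eta0.
pose eps := Num.min (eta / 2) (2^-1) / x.
have eps0 : 0 < eps by rewrite divr_gt0 // lt_min divr_gt0 //= invr_gt0.
have xe : x * eps = Num.min (eta / 2) (2^-1) by rewrite /eps mulrC divfK // gt_eqF.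
have [xe1 xe2] : x * eps <= eta / 2 /\ x * eps <= 2^-1 by rewrite xe !ge_min !lexx orbT.
have xe0 : 0 < x * eps by rewrite mulr_gt0.
have [N _ HN] := sv eps eps0.
near=> n.
have n1 : 1 <= n%:R :> R by near: n; exact: nbhs_infty_ger.
have nN : (N <= n)%N by near: n; exists N.
have gx : eps <= n%:R `^ g by near: n; exact: near_powR_ge.
have n0 : 0 < n%:R :> R by apply: lt_le_trans n1.
have gx0 : 0 < n%:R `^ g :> R by exact: powR_gt0.
pose dl := eps / n%:R `^ g; have dl0 : 0 < dl by rewrite divr_gt0.
have dl1 : dl <= 1 by rewrite ler_pdivrMr // mul1r.
set k := Num.truncn _.
have kx : k%:R * dl <= x * eps.
  rewrite /dl mulrA ler_pdivrMr // mulrAC ler_pM2r //.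
  apply: le_trans (_ : x * n%:R `^ al <= _).
    by rewrite truncn_le mulr_ge0 ?powR_ge0 // ltW.
  by rewrite ler_pM2l //; apply: ler_powR.
have [|H1 H2] := @slowly_varying_iter a dl n k dl0 dl1.
  move=> m nm; have [am A1 A2] := HN m (leq_trans nN nm).
  have [am1 _ _] := HN m.+1 (leqW (leq_trans nN nm)).
  have dm : 1 - dl <= 1 - eps / m%:R `^ g.
    rewrite lerB // ler_pM2l // lef_pV2 ?posrE //.
      by apply: (ge0_ler_powR (ltW g0)); rewrite ?nnegrE ?ler_nat.
    by apply: powR_gt0; apply: lt_le_trans n0 _; rewrite ler_nat.
  split=> //; [apply: le_trans A1|apply: le_trans A2]; by rewrite ler_pM2r.
have [an _ _] := HN n nN.
have [ank _ _] := HN (n + k)%N (leq_trans nN (leq_addr _ _)).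
rewrite distrC; apply: le_trans (ratio_near1 an _ _ H1 H2) _.
- by rewrite mulr_ge0 // ltW.
- by rewrite mulrC -ler_pdivlMr // mul1r; exact: le_trans xe2.
- by rewrite mulrC -ler_pdivlMr //; exact: le_trans xe1.
Unshelve. all: by end_near. Qed.

End SlowVariation.

(** * The cluster size distribution *)

(** Turns the requirement of [balance_ratio] on the number t of steps into a
    bound t <= const dl k.  The constant is unchanged when l is replaced by
    its inverse, so one choice of t serves both directions. *)
Lemma window_bound (R : realFieldType) (l dl k t : R) : 0 < l -> 0 < dl -> dl <= 1 ->
  0 <= k -> t <= l / (4 * (1 + l) ^+ 2) * dl * k ->
  (1 + l) * t <= dl / 2 * (l / (1 + l) * k - t).
Proof.
move=> l0 dl0 dl1 k0 Ht; set r := 1 + l; have r0 : 0 < r by rewrite addr_gt0.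
have r1 : 1 <= r by rewrite lerDl ltW.
pose w := l / r * k; have w0 : 0 <= w by rewrite !mulr_ge0 ?invr_ge0 // ltW.
have H1 : r * t <= dl * w / 4.
  apply: le_trans (ler_wpM2l (ltW r0) Ht) _.
  by rewrite /w -/r le_eqVlt; apply/orP; left; apply/eqP; field; rewrite gt_eqF.
have dw : dl * w <= w by rewrite ler_piMl.
have H2 : t <= w / 4.
  have [t0|/ltW t0] := lerP 0 t; last by apply: le_trans t0 _; rewrite divr_ge0.
  have : t <= r * t by rewrite ler_peMl.
  lra.
rewrite -/w; apply: le_trans H1 _.
have : dl * t <= dl * (w / 4) by rewrite ler_pM2l.
have : 0 <= dl * w by rewrite mulr_ge0 // ltW.
lra.
Qed.

Section ClusterSize.
Variables (R : realType) (d q : nat) (P : probability (Omega d q) R).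

Lemma shell_moment_positive n : positive_functional (shell_moment P n).
Proof.
split.
- move=> phi psi H; apply: ler_sum => A _; apply: ler_wpM2l (H _ _); exact: weight_ge0.
- by move=> c phi; rewrite /shell_moment mulr_sumr; apply: eq_bigr => A _; rewrite mulrCA.
- by move=> phi psi; rewrite /shell_moment -big_split; apply: eq_bigr => A _; rewrite /= mulrDr.
Qed.

Lemma shell_moment1 n : (0 < n)%N -> shell_moment P n (fun _ _ => 1) = prob_size P n.
Proof. by move=> n0; rewrite prob_sizeE //; apply: eq_bigr => A _; rewrite mulr1. Qed.

Lemma shell_moment_few n k : 
  shell_moment P n (fun j e => (j%:R + e%:R < k%:R :> R)%R%:R) <=
  \sum_(A <- animals d n | (#|` shell_centres A| <= k)%N) weight P A.
Proof.
rewrite [leRHS]big_mkcond; apply: ler_sum => A _.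
rewrite -natrD card_open_closed ltr_nat; case: ltnP => [/ltnW -> |_]; first by rewrite mulr1.
by rewrite mulr0; case: ifP => // _; exact: weight_ge0.
Qed.

Lemma prob_size_comparison : (1 < d)%N -> boundary_markov P 1 ->
  translation_invariant P -> finite_energy P ->
  exists2 c : R, 0 < c & \forall n \near \oo, two_sided_comparison (prob_size P) c n.
Proof.
move=> hd PM PT PE.
have [lam lam0 toggle] := weight_toggle hd PM PT PE.
have [L L0 few] := few_shells PE.
have bal := detailed_balance hd toggle.
have LR : 0 < L%:R :> R by rewrite ltr0n.
pose c0 : R := lam / (4 * (1 + lam) ^+ 2).
have lam1 : 0 < 1 + lam by rewrite addr_gt0.
have c00 : 0 < c0 by rewrite divr_gt0 // mulr_gt0 // exprn_gt0.
have ln2 : 0 < ln 2 :> R by rewrite ln_gt0 // ltr1n.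
pose c : R := Num.min (c0 / (2 * L%:R)) (ln 2 / (2 * L%:R)).
have L2 : 0 < 2 * L%:R :> R by rewrite mulr_gt0.
have c_gt0 : 0 < c by rewrite /c lt_min (divr_gt0 c00 L2) (divr_gt0 ln2 L2).
have [cc0 cln] : c <= c0 / (2 * L%:R) /\ c <= ln 2 / (2 * L%:R).
  by rewrite /c !ge_min !lexx orbT.
have c04 : c0 <= 4^-1.
  rewrite /c0 ler_pdivrMr ?mulr_gt0 ?exprn_gt0 // mulrA mulVf // mul1r.
  have : 0 <= lam * lam by rewrite mulr_ge0 // ltW.
  rewrite expr2; lra.
exists c => //; exists L => // n /= Ln dl t /andP[dl0 dl1] tn.
have n0 : (0 < n)%N by apply: leq_trans Ln.
pose k := (n %/ L)%N.
have kL : (k * L <= n)%N by exact: leq_trunc_div.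
have nk : n%:R <= 2 * L%:R * k%:R :> R.
  rewrite -!natrM ler_nat /k.
  have k1 : (0 < n %/ L)%N by rewrite divn_gt0.
  apply: leq_trans (ltnW (ltn_ceil n L0)) _.
  by rewrite mulnAC leq_mul2r mul2n -addnn -add1n leq_add2r k1 orbT.
have ck : c * n%:R <= ln 2 * k%:R.
  apply: le_trans (ler_wpM2l (ltW c_gt0) nk) _.
  apply: le_trans (ler_wpM2r _ cln) _; first by rewrite !mulr_ge0.
  by rewrite mulrA divfK // gt_eqF // mulr_gt0.
have tk : t%:R <= c0 * dl * k%:R.
  apply: le_trans tn _; rewrite mulrAC [leRHS]mulrAC; apply: ler_wpM2r; first exact: ltW.
  apply: le_trans (ler_wpM2l (ltW c_gt0) nk) _.
  apply: le_trans (ler_wpM2r _ cc0) _; first by rewrite !mulr_ge0.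
  by rewrite mulrA divfK // gt_eqF // mulr_gt0.
have t_n : (t < n)%N.
  have kn : k%:R <= n%:R :> R by rewrite ler_nat leq_div.
  have nR : 0 < n%:R :> R by rewrite ltr0n.
  have cd : c0 * dl <= 4^-1.
    by apply: le_trans c04; rewrite ler_piMr // ltW.
  have : c0 * dl * k%:R <= 4^-1 * n%:R by apply: ler_pM => //; exact: mulr_ge0 (ltW c00) (ltW dl0).
  by move=> H; rewrite -(ltr_nat R); lra.
have small : (2^-1) ^+ k <= expR (- c * n%:R).
  rewrite (_ : 2^-1 = expR (- ln 2)); last by rewrite expRN lnK // posrE.
  by rewrite -expRM_natl ler_expR mulNr mulrN lerN2 [leRHS]mulrC.
have lamE : lam^-1 / (4 * (1 + lam^-1) ^+ 2) = c0.
  by rewrite /c0; field; rewrite !gt_eqF // addrC.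
have d1 : 0 <= 1 - dl by rewrite subr_ge0.
split.
(* Closing centres: sizes n+1, n, n-1, ..., with x the number of open centres. *)
- pose F i := shell_moment P (n.+1 - i).
  have Fbal i phi : (i <= t)%N -> F i (fun x y => x%:R * phi x y) =
      lam * F i.+1 (fun x y => y%:R * phi x.+1 y.-1).
    by move=> it; rewrite /F subSS subSn ?bal // (leq_trans it (ltnW t_n)).
  have tB := window_bound lam0 dl0 dl1 (ler0n _ k) tk.
  have := balance_ratio (fun i => shell_moment_positive (n.+1 - i)) Fbal lam0 dl0 dl1 tB.
  rewrite /F subn0 !subSS subn0 !shell_moment1 ?subn_gt0 //.
  apply: le_trans; rewrite ler_wpM2l // lerB // lerB //.
  exact: le_trans (shell_moment_few n k) (le_trans (few _ _ kL) small).
(* Opening centres: sizes n, n+1, ..., with x the number of closed centres. *)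
- pose F i psi := shell_moment P (n + i) (fun j e => psi e j).
  have Fpos i : positive_functional (F i).
    have [m s a] := shell_moment_positive (n + i).
    split=> [phi psi H|x phi|phi psi]; first exact: m.
      exact: s.
    exact: a.
  have Fbal i psi : (i <= t)%N -> F i (fun x y => x%:R * psi x y) =
      lam^-1 * F i.+1 (fun x y => y%:R * psi x.+1 y.-1).
    move=> it; rewrite /F addnS (bal _ (fun j e => psi e.+1 j.-1)) mulKf ?gt_eqF //.
    apply: eq_bigr => A _; congr (_ * _).
    by case: #|` closed_centres A|%fset => [|e] /=; rewrite ?mul0r.
  have laminv0 : 0 < lam^-1 by rewrite invr_gt0.
  have tk' : t%:R <= lam^-1 / (4 * (1 + lam^-1) ^+ 2) * dl * k%:R by rewrite lamE.
  have tB := window_bound laminv0 dl0 dl1 (ler0n _ k) tk'.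
  have := balance_ratio Fpos Fbal laminv0 dl0 dl1 tB.
  rewrite /F addn0 addn1 addnS -addSn !shell_moment1 //.
  apply: le_trans; rewrite ler_wpM2l // lerB // lerB //.
  apply: le_trans (le_trans (few n.+1 k _) small); last exact: leqW.
  apply: le_trans (shell_moment_few n.+1 k).
  have [m _ _] := shell_moment_positive n.+1.
  by apply: m => j e; rewrite addrC.
Qed.

End ClusterSize.

Theorem corollary1p11 (R : realType) (d q : nat) (hd : (2 <= d)%N)
    (hq : (2 <= q)%N) (P : probability (Omega d q) R) (beta : R)
    (hbeta : 0 < beta < 1)
    (Pinv : translation_invariant P)
    (Pmarkov : boundary_markov P 1)
    (Penergy : finite_energy P)
    (Ptail : stretched_exponential_tail P beta) :
  (forall eps : R, 0 < eps ->
     \forall n \near \oo,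
       `|prob_size P n.+1 / prob_size P n - 1|
         <= eps / n%:R `^ ((1 - beta) / 2)) /\
  (forall x alpha : R, 0 < x -> 0 < alpha <= (1 - beta) / 2 ->
     prob_size P (n + Num.truncn (x * n%:R `^ alpha))%N / prob_size P n
       @[n --> \oo] --> (1 : R)).
Proof.
have [nu [/andP[nu0 nu1] cv _]] := Ptail; have /andP[b0 b1] := hbeta.
have g0 : 0 < (1 - beta) / 2 by rewrite divr_gt0 // subr_gt0.
have tail : stretched_tail (prob_size P) beta (- ln nu).
  by apply: stretched_tail_cvg => // n; exact: prob_ge0.
have k0 : 0 < - ln nu by rewrite oppr_gt0 ln_lt0 // nu0.
have [c c0 cmp] := prob_size_comparison hd Pmarkov Pinv Penergy.
have sv := comparison_slowly_varying c0 hbeta k0 tail cmp.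
split=> [eps eps0|x alpha x0 alpha01]; first exact: slowly_varying_ratio1.
by apply: slowly_varying_shift sv x0 alpha01.
Qed.
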